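(* Let $\mu:\mathcal S+\mathcal S^*\to\mathscr L(\mathcal H)$ be a completely positive map, and let $b\in[H^\infty_d\otimes\mathscr L(\mathcal H)]_1$ be such that $\mu=\mu_b$. Then the formula $$\left(\mathcal F_b(p\otimes h)\right)(z)=(I-b(z))\,\mu\left((I-zL^* )^{-1}p\right)h,\qquad p\in\mathcal S,\ h\in\mathcal H,\ z\in\mathbb B^d,$$ defines a unitary transformation $\mathcal F_b$ of $P^2(b)=P^2(\mu)$ onto the deBranges-Rovnyak space $K(b)$.
   Context: Let $d\ge 1$ and let $\mathcal H$ be a non-zero complex Hilbert space, finite dimensional or separable; inner products are conjugate linear in the first argument. $\mathscr L(\cdot)$ denotes bounded linear operators, $\mathbb B^d$ is the open unit ball of $\mathbb C^d$, $zw^*:=\sum_j z_j\overline{w_j}$. $[H^\infty_d\otimes\mathscr L(\mathcal H)]_1$ (the Schur class) is the closed unit ball of the multiplier algebra of the reproducing kernel Hilbert space $H^2_d\otimes\mathcal H$ of $\mathcal H$-valued functions on $\mathbb B^d$ with kernel $\frac1{1-zw^*}I_{\mathcal H}$. For $b$ in the Schur class, $K(b)$ is the reproducing kernel Hilbert space of $\mathcal H$-valued functions on $\mathbb B^d$ with kernel $k^b(z,w)=\frac{I-b(z)b(w)^*}{1-zw^*}$. $F^2_d$ is the full Fock space over $\mathbb C^d$ and $L_jf=e_j\otimes f$ the left creation operators; $zL^*:=\sum_jz_jL_j^*$, $Lz^*:=\sum_j\overline{z_j}L_j$. $\mathcal S$ is the norm-closed linear span of $\{(I-Lz^* )^{-1}:z\in\mathbb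 B^d\}$ and $\mathcal S+\mathcal S^*$ denotes the norm closure of the sum; it satisfies $\mathcal S^*\mathcal S\subset\mathcal S+\mathcal S^*$. For $b$ in the Schur class with $I-b(z)$ invertible for all $z\in\mathbb B^d$, $\mu=\mu_b$ means that $\mu$ is the (unique) completely positive map on $\mathcal S+\mathcal S^*$ with $$\mu\left((I-zL^* )^{-1}(I-Lw^* )^{-1}\right)=\tfrac12\frac{H_b(z)+H_b(w)^*}{1-zw^*},\qquad H_b(z)=(I-b(z))^{-1}(I+b(z)),\quad z,w\in\mathbb B^d.$$ Every completely positive $\mu:\mathcal S+\mathcal S^*\to\mathscr L(\mathcal H)$ arises this way. $P^2(\mu)$ is the Hilbert space obtained from the algebraic tensor product $\mathcal S\otimes\mathcal H$ with pre-inner product $\langle p\otimes h,q\otimes g\rangle_\mu=\langle h,\mu(p^*q)g\rangle_{\mathcal H}$ by quotienting by the null vectors and completing; one writes $P^2(b)=P^2(\mu_b)$. *)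

(* Defs.v *)
From HB Require Import structures.
From mathcomp Require Import all_boot all_order all_algebra.
From mathcomp Require Import all_classical all_reals all_analysis.
From mathcomp Require Import complex ring lra.

Set Implicit Arguments.
Unset Strict Implicit.
Unset Printing Implicit Defensive.

Import Order.TTheory GRing.Theory Num.Theory.
Import numFieldNormedType.Exports.

Local Open Scope classical_set_scope.
Local Open Scope ring_scope.
Local Notation "x %:C" := (real_complex _ x) : ring_scope.
Local Notation "x +i* y" := (Complex x y) : ring_scope.

(* Inner products are conjugate linear in the first argument. *)
HB.mixin Record CompleteNormedModule_isHilbert (R : realType) V
    & CompleteNormedModule R[i] V := {
  ip : V -> V -> R[i];
  ip_scalar : forall x, scalar (ip x);
  ip_conj : forall x y, ip y x = (ip x y)^*;
  ip_norm : forall x, ip x x = `|x| ^+ 2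
}.

#[short(type="hilbertType")]
HB.structure Definition Hilbert (R : realType) :=
  {V of CompleteNormedModule R[i] V & CompleteNormedModule_isHilbert R V}.

Definition lspan (K : pzRingType) (V : lmodType K) (A : set V) : set V :=
  [set v | exists n (c : 'I_n -> K) (x : 'I_n -> V),
      (forall i, A (x i)) /\ v = \sum_i c i *: x i].

Definition separable (T : topologicalType) :=
  exists A : set T, countable A /\ dense A.

Section BoundedOperators.
Variable R : realType.
Implicit Types V W : normedModType R[i].

Definition bop_pred V W : {pred V -> W} :=
  fun f => `[< linear f /\ continuous f >].

Record bop V W := Bop { bop_fun :> V -> W; bop_funP : bop_fun \in @bop_pred V W }.

HB.instance Definition _ V W := [isSub for @bop_fun V W].
HB.instance Definition _ V W := [Choice of bop V W by <:].

Lemma bop_submod_closed V W : submod_closed (@bop_pred V W).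
Proof.
split.
  apply/asboolP; split; last by move=> x; exact: cvg_cst.
  by move=> a x y; rewrite [RHS]addr0 [RHS]scaler0.
move=> a f g /asboolP[lf cf] /asboolP[lg cg]; apply/asboolP; split.
  move=> c x y; rewrite -[LHS]/(a *: f _ + g _) -[RHS]/(c *: (a *: f _ + g _) + (a *: f _ + g _)) lf lg !scalerDr !scalerA (mulrC a c) -!addrA.
  by congr (_ + _); rewrite addrCA.
by move=> x; apply: cvgD; [apply: cvgZr; exact: cf|exact: cg].
Qed.

HB.instance Definition _ V W :=
  GRing.isSubmodClosed.Build R[i] (V -> W) (@bop_pred V W) (@bop_submod_closed V W).
HB.instance Definition _ V W := [SubChoice_isSubLmodule of bop V W by <:].

Lemma bop_linear V W (T : bop V W) : linear T.
Proof. by have /asboolP[] := bop_funP T. Qed.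

Lemma bop_continuous V W (T : bop V W) : continuous T.
Proof. by have /asboolP[] := bop_funP T. Qed.

HB.instance Definition _ V W (T : bop V W) :=
  GRing.isLinear.Build R[i] V W _ T (bop_linear T).

Definition opnorm V W (T : bop V W) : R :=
  sup [set complex.Re `|T x| | x in [set x : V | `|x| <= 1]].

Lemma Re_normK V (x : V) : (complex.Re `|x|)%:C = `|x|.
Proof. by rewrite RRe_real// normr_real. Qed.

Lemma opnorm_has_sup V W (T : bop V W) :
  has_sup [set complex.Re `|T x| | x in [set x : V | `|x| <= 1]].
Proof.
split; first by exists (complex.Re `|T 0|), 0 => //=; rewrite normr0.
have /linear_bounded_continuous/linear_boundedP := @bop_continuous V W T.
move=> /pinfty_ex_gt0[M M0 TM]; exists (complex.Re M) => _ [x /= x1 <-].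
rewrite -lecR Re_normK RRe_real ?gtr0_real//.
by rewrite (le_trans (TM x))// ler_piMr// ltW.
Qed.

Lemma opnorm_ge0 V W (T : bop V W) : 0 <= opnorm T.
Proof.
have /sup_upper_bound := opnorm_has_sup T; apply.
by exists 0; rewrite /= ?normr0// linear0 normr0.
Qed.

Lemma opnorm_le V W (T : bop V W) x : `|T x| <= (opnorm T)%:C * `|x|.
Proof.
have [->|x0] := eqVneq x 0; first by rewrite linear0 !normr0 mulr0.
have nx0 : 0 < `|x| by rewrite normr_gt0.
rewrite -ler_pdivrMr// mulrC -[X in X * _]ger0_norm ?invr_ge0// -normrZ -linearZ.
rewrite -(Re_normK (T _)) lecR; have /sup_upper_bound := opnorm_has_sup T; apply.
by exists (`|x|^-1 *: x) => //=; rewrite normrZ normfV normr_id mulVf// gt_eqF.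
Qed.

Lemma le_opnorm V W (T : bop V W) (c : R) : 0 <= c ->
  (forall x, `|T x| <= c%:C * `|x|) -> opnorm T <= c.
Proof.
move=> c0 Tc; apply: ge_sup; first by have [] := opnorm_has_sup T.
move=> _ [x /= x1 <-]; rewrite -lecR Re_normK (le_trans (Tc x))// ler_piMr//.
by rewrite ler0c.
Qed.

Lemma opnormD V W (S T : bop V W) :
  (opnorm (S + T))%:C <= (opnorm S)%:C + (opnorm T)%:C.
Proof.
rewrite -rmorphD lecR le_opnorm ?addr_ge0 ?opnorm_ge0// => x.
by rewrite rmorphD mulrDl (le_trans (ler_normD _ _))// lerD// opnorm_le.
Qed.

Lemma opnormZ V W (a : R[i]) (T : bop V W) :
  (opnorm (a *: T))%:C = `|a| * (opnorm T)%:C.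
Proof.
have le b (S : bop V W) : (opnorm (b *: S))%:C <= `|b| * (opnorm S)%:C.
  have bE := RRe_real (normr_real b).
  rewrite -bE -rmorphM lecR le_opnorm// ?mulr_ge0 ?opnorm_ge0//.
    by rewrite -ler0c bE.
  by move=> x; rewrite rmorphM /= bE normrZ -mulrA ler_wpM2l// opnorm_le.
apply/eqP; rewrite eq_le le/=; have [->|a0] := eqVneq a 0.
  by rewrite normr0 mul0r ler0c opnorm_ge0.
rewrite mulrC -ler_pdivlMr ?normr_gt0// mulrC -normfV (le_trans _ (le _ _))//.
by rewrite scalerA mulVf// scale1r.
Qed.

Lemma opnorm_eq0 V W (T : bop V W) : (opnorm T)%:C = 0 -> T = 0.
Proof.
move=> T0; apply/val_inj/funext => x; apply/eqP.
by rewrite -normr_le0; have := opnorm_le T x; rewrite T0 mul0r.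
Qed.

HB.instance Definition _ V W :=
  Lmodule_isNormed.Build R[i] (bop V W) (@opnormD V W) (@opnormZ V W) (@opnorm_eq0 V W).

Definition bid V : bop V V.
Proof.
by exists idfun; apply/asboolP; split => // x; exact: cvg_id.
Defined.

Definition bcomp U V W (S : bop V W) (T : bop U V) : bop U W.
Proof.
exists (S \o T); apply/asboolP; split; first by move=> a x y /=; rewrite !linearP.
by move=> x; apply: continuous_comp; exact: bop_continuous.
Defined.

End BoundedOperators.

Notation "S \bo T" := (bcomp S T) (at level 40, left associativity) : ring_scope.

Section InnerProductNorm.
Variables (R : realType) (V : lmodType R[i]) (f : V -> V -> R[i]).
Hypothesis f_scalar : forall x, scalar (f x).
Hypothesis f_conj : forall x y, f y x = (f x y)^*.
Hypothesis f_ge0 : forall x, 0 <= f x x.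
Hypothesis f_eq0 : forall x, f x x = 0 -> x = 0.

Lemma preipD x y z : f x (y + z) = f x y + f x z.
Proof. by rewrite -[y]scale1r f_scalar mul1r scale1r. Qed.

Lemma preip0 x : f x 0 = 0.
Proof. by apply: (addrI (f x 0)); rewrite -preipD !addr0. Qed.

Lemma preipZ x a y : f x (a *: y) = a * f x y.
Proof. by rewrite -[a *: y]addr0 f_scalar preip0 addr0. Qed.

Lemma preipDl x y z : f (x + y) z = f x z + f y z.
Proof. by rewrite f_conj preipD rmorphD /= -!f_conj. Qed.

Lemma preipZl a x y : f (a *: x) y = a^* * f x y.
Proof. by rewrite f_conj preipZ rmorphM /= -f_conj. Qed.

Lemma preip_CauchySchwarz x y : `|f x y| ^+ 2 <= f x x * f y y.
Proof.
have [->|y0] := eqVneq y 0; first by rewrite !preip0 normr0 expr0n mulr0.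
have fy : 0 < f y y by rewrite lt_neqAle f_ge0 eq_sym andbT; apply: contra_neq y0; exact: f_eq0.
pose a : R[i] := - (f y x / f y y).
suff E : f (x + a *: y) (x + a *: y) * f y y = f x x * f y y - `|f x y| ^+ 2.
  by rewrite -subr_ge0 -E mulr_ge0.
have qJ : (f y y)^* = f y y by rewrite -f_conj.
rewrite preipD !preipDl !preipZ !preipZl normCK -(f_conj x y).
have -> : a^* = - (f x y / f y y).
  by rewrite /a rmorphN fmorph_div /= qJ -f_conj.
rewrite /a; field; exact: lt0r_neq0.
Qed.

Lemma preip_triangle x y : sqrtC (f (x + y) (x + y)) <= sqrtC (f x x) + sqrtC (f y y).
Proof.
have s0 z : 0 <= sqrtC (f z z) by rewrite sqrtC_ge0.
rewrite -(@ler_pXn2r _ 2)// ?nnegrE ?addr_ge0//.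
rewrite sqrrD !sqrtCK preipD !preipDl.
have CS : `|f x y| <= sqrtC (f x x) * sqrtC (f y y).
  rewrite -(@ler_pXn2r _ 2)// ?nnegrE ?mulr_ge0//.
  by rewrite exprMn !sqrtCK preip_CauchySchwarz.
have -> : f x x + f y x + (f x y + f y y) = f x x + (f x y + (f x y)^*) + f y y.
  by rewrite (f_conj x y); ring.
rewrite lerD2r lerD2l addcJ mulr2n -mulr2n -[leRHS]mulr_natl ler_pM2l//.
apply: le_trans CS; apply: le_trans (normc_ge_Re _); rewrite lecR; exact: ler_norm.
Qed.

Lemma preip_norm0 x : sqrtC (f x x) = 0 -> x = 0.
Proof. by move=> /eqP; rewrite sqrtC_eq0 => /eqP /f_eq0. Qed.

Lemma preip_normZ a x : sqrtC (f (a *: x) (a *: x)) = `|a| * sqrtC (f x x).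
Proof.
rewrite preipZ preipZl mulrA -normCK rootCMl ?exprn_ge0//.
by rewrite sqrCK.
Qed.

End InnerProductNorm.

Section Fock.
Variables (R : realType) (d : nat).
Local Notation C := R[i].
Local Notation word := (seq 'I_d).
Implicit Types f g h : word -> C.

(* The degree k component (C^d)^(x)k of the Fock space has the orthonormal basis
   e_(w_1) (x) ... (x) e_(w_k) indexed by the words of length k, and an element
   is the family of its coordinates; [level k f g] is the inner product of the
   degree k components. *)
Definition level k f g : C := \sum_(w : k.-tuple 'I_d) (f w)^* * g w.

Definition fock_pred : {pred word -> C} :=
  fun f => `[< cvgn (series (fun k => complex.Re (level k f f))) >].

Record fock := Fock { fock_fun :> word -> C; fock_funP : fock_fun \in fock_pred }.

HB.instance Definition _ := [isSub for fock_fun].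
HB.instance Definition _ := [Choice of fock by <:].

Lemma Re_levelE k f : complex.Re (level k f f) =
  \sum_(w : k.-tuple 'I_d) (complex.Re (f w) ^+ 2 + complex.Im (f w) ^+ 2).
Proof.
rewrite /level (raddf_sum (@complex.Re R : Rcomplex R -> R)); apply: eq_bigr => w _.
by case: (f w) => a b /=; rewrite mulNr opprK -!expr2.
Qed.

Lemma Re_level_ge0 k f : 0 <= complex.Re (level k f f).
Proof. by rewrite Re_levelE sumr_ge0// => w _; rewrite addr_ge0 ?sqr_ge0. Qed.

Lemma level_real k f : level k f f = (complex.Re (level k f f))%:C.
Proof.
rewrite RRe_real// ger0_real// sumr_ge0// => w _.
by rewrite mulrC mulcJ_ge0.
Qed.

Lemma level_linear k f : scalar (level k f).
Proof.
move=> a g h; rewrite /level mulr_sumr -big_split; apply: eq_bigr => w _ /=.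
by rewrite mulrDr mulrCA.
Qed.

Lemma level_conj k f g : level k g f = (level k f g)^*.
Proof.
rewrite /level rmorph_sum; apply: eq_bigr => w _ /=.
by rewrite rmorphM /= conjCK mulrC.
Qed.

Lemma Re_norm_sqr (a : C) :
  (complex.Re `|a|) ^+ 2 = complex.Re a ^+ 2 + complex.Im a ^+ 2.
Proof. by apply: complexI; rewrite add_Re2_Im2 -[in RHS](RRe_real (normr_real a)) rmorphXn. Qed.

Lemma Re_levelD k (a : C) f g : complex.Re (level k (a *: f + g) (a *: f + g)) <=
  2 * (complex.Re `|a|) ^+ 2 * complex.Re (level k f f) + 2 * complex.Re (level k g g).
Proof.
rewrite !Re_levelE !mulr_sumr -big_split/=; apply: ler_sum => w _.
rewrite -[(a *: f + g) _]/(a * f w + g w).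
rewrite Re_norm_sqr; case: a => a1 a2; case: (f w) => x y; case: (g w) => u v /=.
rewrite -subr_ge0.
set E := (X in 0 <= X).
suff -> : E = (a1 * x - a2 * y - u) ^+ 2 + (a1 * y + a2 * x - v) ^+ 2.
  by rewrite addr_ge0 ?sqr_ge0.
by rewrite /E; ring.
Qed.

Lemma fock_submod_closed : submod_closed fock_pred.
Proof.
split.
  apply/asboolP; apply: (@is_cvg_near_cst _ _ 0); apply: nearW => n.
  rewrite /series/= big1// => k _; rewrite Re_levelE big1// => w _ /=.
  by rewrite expr0n/= addr0.
move=> a f g /asboolP cf /asboolP cg; apply/asboolP.
apply: (@series_le_cvg _ _
    (((2 * (complex.Re `|a|) ^+ 2) *: (fun k => complex.Re (level k f f))) +
     (2 *: (fun k => complex.Re (level k g g))))).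
- by move=> k; exact: Re_level_ge0.
- by move=> k; rewrite addr_ge0// mulr_ge0 ?Re_level_ge0// mulr_ge0 ?sqr_ge0.
- by move=> k; exact: Re_levelD.
- by apply: is_cvg_seriesD; exact: is_cvg_seriesZ.
Qed.

HB.instance Definition _ :=
  GRing.isSubmodClosed.Build C (word -> C) fock_pred fock_submod_closed.
HB.instance Definition _ := [SubChoice_isSubLmodule of fock by <:].

Definition ReS (u : nat -> C) : R ^nat := fun k => complex.Re (u k).
Definition ImS (u : nat -> C) : R ^nat := fun k => complex.Im (u k).

(* componentwise, as the library does not provide the completeness of R[i] *)
Definition csum (u : nat -> C) : C := limn (series (ReS u)) +i* limn (series (ImS u)).

Definition csummable (u : nat -> C) := cvgn (series (ReS u)) /\ cvgn (series (ImS u)).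

Lemma csum_linear a (u v : nat -> C) : csummable u -> csummable v ->
  csum (fun k => a * u k + v k) = a * csum u + csum v.
Proof.
move=> [ru iu] [rv iv]; case: a => a b.
rewrite /csum; have -> : ReS (fun k => (a +i* b) * u k + v k) =
    a *: ReS u + (- b) *: ImS u + ReS v.
  apply/funext => k; rewrite -[RHS]/(a * complex.Re (u k) + - b * complex.Im (u k) + complex.Re (v k)) /ReS.
  by case: (u k) => x y; case: (v k) => z t /=; rewrite mulNr.
have -> : ImS (fun k => (a +i* b) * u k + v k) =
    a *: ImS u + b *: ReS u + ImS v.
  apply/funext => k; rewrite -[RHS]/(a * complex.Im (u k) + b * complex.Re (u k) + complex.Im (v k)) /ImS.
  by case: (u k) => x y; case: (v k) => z t /=; rewrite [b * x]mulrC.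
have Z k (f : R ^nat) : cvgn (series f) -> cvgn (series (k *: f)).
  exact: is_cvg_seriesZ.
have L k l (f g h : R ^nat) : cvgn (series f) -> cvgn (series g) -> cvgn (series h) ->
    limn (series (k *: f + l *: g + h)) =
    k * limn (series f) + l * limn (series g) + limn (series h).
  move=> cf cg ch; rewrite lim_seriesD//; last by apply: is_cvg_seriesD; exact: Z.
  by rewrite (lim_seriesD (Z _ _ cf) (Z _ _ cg)) !lim_seriesZ.
by rewrite !L//= mulNr.
Qed.

Lemma csum_conj (u : nat -> C) : csummable u -> csum (fun k => (u k)^*) = (csum u)^*.
Proof.
move=> [ru iu]; rewrite /csum.
have -> : ReS (fun k => (u k)^*) = ReS u by apply/funext => k; rewrite /ReS; case: (u k).
have -> : ImS (fun k => (u k)^*) = - ImS u.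
  by apply/funext => k; rewrite -[RHS]/(- complex.Im (u k)) /ImS; case: (u k).
by rewrite lim_seriesN.
Qed.

Implicit Types F G : fock.

Lemma fock_cvg F : cvgn (series (fun k => complex.Re (level k F F))).
Proof. by have /asboolP := fock_funP F. Qed.

Lemma level_summable F G : csummable (fun k => level k F G).
Proof.
have Q : cvgn (series ((fun k => complex.Re (level k F F)) + (fun k => complex.Re (level k G G)))).
  by apply: is_cvg_seriesD; exact: fock_cvg.
split; apply: normed_cvg.
all: apply: (series_le_cvg _ _ _ Q) => k //=; first by rewrite addr_ge0 ?Re_level_ge0.
all: rewrite -[leRHS]/(complex.Re (level k F F) + complex.Re (level k G G)).
all: rewrite !Re_levelE -big_split/= /ReS/ImS/level.
1: rewrite (raddf_sum (@complex.Re R : Rcomplex R -> R)).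
2: rewrite (raddf_sum (@complex.Im R : Rcomplex R -> R)).
all: rewrite (le_trans (ler_norm_sum _ _ _))//; apply: ler_sum => w _.
all: case: (fock_fun F w) => x y; case: (fock_fun G w) => u v /=; rewrite ler_norml.
all: have := (sqr_ge0 (x + u), sqr_ge0 (x - u), sqr_ge0 (y + v), sqr_ge0 (y - v)).
all: have := (sqr_ge0 (x + v), sqr_ge0 (x - v), sqr_ge0 (y + u), sqr_ge0 (y - u)).
all: move=> [[[h1 h2] h3] h4] [[[h5 h6] h7] h8].
all: have := (sqr_ge0 x, sqr_ge0 y, sqr_ge0 u, sqr_ge0 v); move=> [[[k1 k2] k3] k4].
all: by apply/andP; split; nra.
Qed.

Definition fock_ip F G : C := csum (fun k => level k F G).

Lemma fock_ip_scalar F : scalar (fock_ip F).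
Proof.
move=> a G H; rewrite /fock_ip -csum_linear; try exact: level_summable.
by congr csum; apply/funext => k; exact: level_linear.
Qed.

Lemma fock_ip_conj F G : fock_ip G F = (fock_ip F G)^*.
Proof.
rewrite /fock_ip -csum_conj; last exact: level_summable.
by congr csum; apply/funext => k; exact: level_conj.
Qed.

Lemma fock_ipE F : fock_ip F F = (limn (series (fun k => complex.Re (level k F F))))%:C.
Proof.
rewrite /fock_ip /csum; congr (_ +i* _).
rewrite (_ : series _ = cst 0) ?lim_cst//.
by apply/funext => n; rewrite /series/= big1// => k _; rewrite /ImS level_real.
Qed.

Lemma le_fock_ip F n : (series (fun k => complex.Re (level k F F)) n)%:C <= fock_ip F F.
Proof.
rewrite fock_ipE lecR; apply: nondecreasing_cvgn_le; last exact: fock_cvg.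
by apply: nondecreasing_series => k _ _; exact: Re_level_ge0.
Qed.

Lemma fock_ip_ge0 F : 0 <= fock_ip F F.
Proof. by have := le_fock_ip F 0; rewrite /series/= big_geq. Qed.

Lemma fock_coord F (w : word) : `|F w| ^+ 2 <= fock_ip F F.
Proof.
apply: le_trans (le_fock_ip F (size w).+1); rewrite -add_Re2_Im2 lecR.
rewrite /series/= big_nat_recr//= ler_wpDl//.
  by apply: sumr_ge0 => k _; exact: Re_level_ge0.
rewrite Re_levelE (bigD1 (in_tuple w))//= lerDl.
by apply: sumr_ge0 => v _; rewrite addr_ge0 ?sqr_ge0.
Qed.

Lemma fock_ip_eq0 F : fock_ip F F = 0 -> F = 0.
Proof.
move=> F0; apply/val_inj/funext => w; apply/eqP.
rewrite -normr_eq0 -sqrf_eq0 eq_le exprn_ge0// andbT -F0.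
exact: fock_coord.
Qed.

Definition fock_norm F : C := sqrtC (fock_ip F F).

HB.instance Definition _ := Lmodule_isNormed.Build C fock
  (preip_triangle fock_ip_scalar fock_ip_conj fock_ip_ge0 fock_ip_eq0)
  (preip_normZ fock_ip_scalar fock_ip_conj)
  (preip_norm0 fock_ip_eq0).

Lemma fock_ip_norm F : fock_ip F F = `|F| ^+ 2.
Proof. by rewrite -[`|F|]/(fock_norm F) sqrtCK. Qed.

Lemma fock_coord_norm F (w : word) : `|F w| <= `|F|.
Proof. by rewrite -(@ler_pXn2r _ 2)// ?nnegrE// -fock_ip_norm fock_coord. Qed.

Lemma fock_norm_le (f : word -> C) (e : R) : 0 <= e ->
  (forall n, series (fun k => complex.Re (level k f f)) n <= e ^+ 2) ->
  exists2 F : fock, fock_fun F = f & `|F| <= e%:C.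
Proof.
move=> e0 fe; have cf : cvgn (series (fun k => complex.Re (level k f f))).
  apply: nondecreasing_is_cvgn; last by exists (e ^+ 2) => _ [n _ <-].
  by apply: nondecreasing_series => k _ _; exact: Re_level_ge0.
have fP : f \in fock_pred by apply/asboolP.
exists (Fock fP) => //.
rewrite -(@ler_pXn2r _ 2)// ?nnegrE ?ler0c// -fock_ip_norm fock_ipE -rmorphXn lecR.
by apply: limr_le => //; apply: nearW.
Qed.

Lemma fock_complete (FF : set_system fock) : ProperFilter FF -> cauchy FF -> cvg FF.
Proof.
move=> PF /cauchy_ballP FC.
have {}FC (e : R) : 0 < e -> \forall x \near FF, \forall y \near FF, `|x - y| < e%:C.
  move=> e0; have := FC e%:C; rewrite -ltcR in e0 => /(_ e0).
  by move/nearP_dep; rewrite -ball_normE.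
have cR (p : C -> R) : (forall a b, p (a - b) = p a - p b) ->
    (forall a, (`|p a|)%:C <= `|a|) -> forall w, cvg ((fun x : fock => p (x w)) @ FF).
  move=> pB pn w; apply/cauchy_cvgP; apply: cauchy_exP => e e0.
  have [x xF] := filter_ex (FC _ e0); exists (p (x w)).
  apply: filterS xF => y xy; rewrite -ball_normE /ball_/= -pB -ltcR.
  apply: le_lt_trans xy; apply: (le_trans (pn _)).
  exact: (fock_coord_norm (x - y) w).
have cRe : forall w, cvg ((fun x : fock => complex.Re (x w)) @ FF).
  by apply: (cR (@complex.Re R)); [case=> ? ? [? ?]|exact: normc_ge_Re].
have cIm : forall w, cvg ((fun x : fock => complex.Im (x w)) @ FF).
  apply: (cR (@complex.Im R)); first by case=> ? ? [? ?].
  move=> a; have := normc_ge_Re (a * (0 +i* 1)).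
  rewrite normrM ReiNIm normrN (_ : `|0 +i* 1| = 1) ?mulr1//.
  by rewrite normc_def/= expr0n/= expr1n add0r sqrtr1.
pose g w : C := lim ((fun x : fock => complex.Re (x w)) @ FF) +i*
                lim ((fun x : fock => complex.Im (x w)) @ FF).
have key e : 0 < e -> \forall x \near FF, exists2 y : fock,
    fock_fun y = fock_fun x - g & `|y| <= e%:C.
  move=> e0; apply: filterS (FC _ e0) => x xF.
  apply: fock_norm_le; first exact: ltW.
  move=> n; pose S (y : word -> C) : R := series (fun k => complex.Re (level k y y)) n.
  apply: (@cvgr_to_le _ FF _ _ (fun y => S (fock_fun (x - y))) (S (fock_fun x - g))).
    have SE y : S (fock_fun x - y) = \sum_(0 <= k < n) \sum_(w : k.-tuple 'I_d)
        ((complex.Re (x w) - complex.Re (y w)) ^+ 2 +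
         (complex.Im (x w) - complex.Im (y w)) ^+ 2).
      apply: eq_bigr => k _; rewrite Re_levelE; apply: eq_bigr => w _.
      by rewrite -[(_ - y) w]/(x w - y w); case: (x w) (y w) => ? ? [? ?].
    rewrite SE (eq_cvg _ _ (fun y => SE (fock_fun y))).
    apply: cvg_big => [|k _]; first exact: add_continuous.
    apply: cvg_big => [|w _]; first exact: add_continuous.
    have cB (u : fock -> R) c : cvg (u @ FF) ->
        (fun y => (c - u y) ^+ 2) @ FF --> (c - lim (u @ FF)) ^+ 2.
      by move=> cu; rewrite expr2; apply: cvgM; (apply: cvgB; [exact: cvg_cst|]).
    by apply: cvgD; [exact: cB (cRe w)|exact: cB (cIm w)].
  apply: filterS xF => y xy; rewrite -lecR rmorphXn.
  have := le_fock_ip (x - y) n; rewrite fock_ip_norm => /le_trans; apply.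
  by rewrite ler_pXn2r// ?nnegrE ?ler0c// ltW.
have [x [y yE _]] := filter_ex (key _ ltr01).
pose G : fock := x - y.
have GE : fock_fun G = g.
  by rewrite -[LHS]/(fock_fun x - fock_fun y) yE opprB addrC subrK.
apply/cvg_ex; exists G; apply/cvgrPdist_le => e e0.
have eE : e = (complex.Re e)%:C by rewrite RRe_real ?gtr0_real.
have e0' : 0 < complex.Re e by rewrite -ltcR -eE.
apply: filterS (key _ e0') => z [t tE te].
rewrite eE distrC (_ : z - G = t)//; apply/val_inj.
by rewrite /= tE -GE.
Qed.

HB.instance Definition _ := Uniform_isComplete.Build fock fock_complete.

HB.instance Definition _ := CompleteNormedModule_isHilbert.Build R fock
  fock_ip_scalar fock_ip_conj fock_ip_norm.

(* e_j (x) f, whose component of degree 0 vanishes *)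
Definition creation_fun (j : 'I_d) f : word -> C :=
  fun w => if w is i :: v then (i == j)%:R * f v else 0.

Lemma level_creation j f k :
  level k (creation_fun j f) (creation_fun j f) = if k is k'.+1 then level k' f f else 0.
Proof.
case: k => [|k]; first by rewrite /level big1// => w _; rewrite tuple0 /= mulr0.
rewrite /level (reindex (fun p : 'I_d * k.-tuple 'I_d => cons_tuple p.1 p.2))/=; last first.
  exists (fun t : k.+1.-tuple 'I_d => (thead t, behead_tuple t)) => [[i t] _|t _] /=.
    by congr (_, _); apply/val_inj.
  by case/tupleP: t => i t; apply/val_inj.
rewrite -(pair_bigA _ (fun i (t : k.-tuple 'I_d) =>
  ((i == j)%:R * f t)^* * ((i == j)%:R * f t)))/=.
rewrite (bigD1 j)//= [X in _ + X]big1 ?addr0 => [|i /negPf ->].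
  by apply: eq_bigr => w _; rewrite eqxx mul1r.
by apply: big1 => w _; rewrite mul0r mulr0.
Qed.

Lemma series_creation j f n :
  series (fun k => complex.Re (level k (creation_fun j f) (creation_fun j f))) n <=
  series (fun k => complex.Re (level k f f)) n.
Proof.
case: n => [|n]; first by rewrite /series/= !big_geq.
rewrite /series/= big_nat_recl// big_nat_recr//= level_creation add0r.
under eq_bigr do rewrite level_creation.
by rewrite lerDl Re_level_ge0.
Qed.

Lemma creation_le j F : exists2 G : fock, fock_fun G = creation_fun j F & `|G| <= `|F|.
Proof.
rewrite -[`|F|]Re_normK; apply: fock_norm_le; first by rewrite -ler0c Re_normK.
move=> n; apply: le_trans (series_creation _ _ _) _.
rewrite -lecR rmorphXn /= [X in _ <= X ^+ 2]Re_normK -fock_ip_norm.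
exact: le_fock_ip.
Qed.

Lemma creation_funP j F : creation_fun j F \in fock_pred.
Proof. by have [G <- _] := creation_le j F; exact: fock_funP. Qed.

Definition creation_fock j F : fock := Fock (creation_funP j F).

Lemma creation_linear j : linear (creation_fock j).
Proof.
move=> a F G; apply/val_inj/funext => -[|i w] /=.
  by rewrite -[RHS]/(a * 0 + 0) mulr0 addr0.
rewrite -[LHS]/(_ * (a * F w + G w)) -[RHS]/(a * (_ * F w) + _ * G w).
by rewrite mulrDr mulrCA.
Qed.

HB.instance Definition _ j :=
  GRing.isLinear.Build C fock fock _ (creation_fock j) (creation_linear j).

Lemma creation_continuous j : continuous (creation_fock j).
Proof.
apply/linear_bounded_continuous/linear_boundedP.
apply: (@filterS _ _ _ (fun r : C => 1 <= r)); last exact: nbhs_pinfty_ge.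
move=> r r1 F; apply: le_trans (_ : `|F| <= _); last by rewrite ler_peMl.
have [G GE] := creation_le j F.
by rewrite (_ : G = creation_fock j F)//; apply/val_inj.
Qed.

Lemma creationP j : creation_fock j \in @bop_pred R fock fock.
Proof. by apply/asboolP; split; [exact: creation_linear|exact: creation_continuous]. Qed.

Definition creation (j : 'I_d) : bop fock fock := Bop (creationP j).

End Fock.

Section HilbertOperators.
Variable R : realType.
Implicit Types V W : hilbertType R.

(* the default value 0 is never reached: bounded operators have adjoints *)
Definition adj V W (T : bop V W) : bop W V :=
  xget 0 [set S : bop W V | forall x y, ip (T x) y = ip x (S y)].

Definition inverse_of V W (T : bop V W) (S : bop W V) :=
  S \bo T = bid V /\ T \bo S = bid W.

Definition invertible V W (T : bop V W) := exists S, inverse_of T S.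

(* meaningful for invertible operators only, and 0 for the others *)
Definition binv V W (T : bop V W) : bop W V := xget 0 [set S | inverse_of T S].

Definition unitary V W (U : bop V W) :=
  (forall x y, ip (U x) (U y) = ip x y) /\ (forall y, exists x, U x = y).

(* positivity of [A i j] as an operator on the direct sum of n copies of V *)
Definition block_positive V n (A : 'I_n -> 'I_n -> bop V V) :=
  forall x : 'I_n -> V, 0 <= \sum_i \sum_j ip (x i) (A i j (x j)).

(* mu is a map on the operator system D; its values outside D are irrelevant *)
Definition completely_positive V W (D : set (bop V V)) (mu : bop V V -> bop W W) :=
  (forall a A B, D A -> D B -> mu (a *: A + B) = a *: mu A + mu B) /\
  (forall n (A : 'I_n -> 'I_n -> bop V V), (forall i j, D (A i j)) ->
     block_positive A -> block_positive (fun i j => mu (A i j))).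

End HilbertOperators.

(* The reproducing kernel Hilbert space of H-valued functions on X with kernel
   k, up to the identification of its elements with functions on X. *)
Record rkhs (R : realType) (X : Type) (H : hilbertType R)
    (k : X -> X -> bop H H) := Rkhs {
  rkhs_space :> hilbertType R;
  rkhs_eval : {linear rkhs_space -> (X -> H)};
  rkhs_eval_inj : injective rkhs_eval;
  rkhs_kernel : forall w h, exists kwh : rkhs_space,
    rkhs_eval kwh = (fun z => k z w h) /\
    forall f, ip kwh f = ip h (rkhs_eval f w)
}.

Section UnitBall.
Variables (R : realType) (d : nat).

Definition rowprod (z w : 'rV[R[i]]_d) : R[i] := \sum_j z ord0 j * (w ord0 j)^*.

Definition unit_ball := {z : 'rV[R[i]]_d | rowprod z z < 1}.

(* in row notation, Lstar w is Lw^* and starL z is zL^* *)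
Definition Lstar (w : 'rV[R[i]]_d) : bop (fock R d) (fock R d) :=
  \sum_j (w ord0 j)^* *: creation R j.

Definition starL (z : 'rV[R[i]]_d) : bop (fock R d) (fock R d) :=
  \sum_j z ord0 j *: adj (creation R j).

Definition resolvent (w : unit_ball) : bop (fock R d) (fock R d) :=
  binv (bid _ - Lstar (sval w)).

Definition resolvent_star (z : unit_ball) : bop (fock R d) (fock R d) :=
  binv (bid _ - starL (sval z)).

(* the closed linear span S of the resolvents of L, and the closure of S + S^* *)
Definition opS : set (bop (fock R d) (fock R d)) :=
  closure (lspan (range resolvent)).

Definition opSS : set (bop (fock R d) (fock R d)) :=
  closure [set A + adj B | A in opS & B in opS].

End UnitBall.

Arguments opS R d : clear implicits.
Arguments opSS R d : clear implicits.

Section DeBrangesRovnyak.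
Variables (R : realType) (d : nat) (H : hilbertType R).
Local Notation ball := (unit_ball R d).
Local Notation LF := (bop (fock R d) (fock R d)).
Implicit Types b : ball -> bop H H.

Definition szego_kernel (z w : ball) : bop H H :=
  (1 - rowprod (sval z) (sval w))^-1 *: bid H.

Definition dBR_kernel b (z w : ball) : bop H H :=
  (1 - rowprod (sval z) (sval w))^-1 *: (bid H - (b z \bo adj (b w))).

(* b belongs to the closed unit ball of the multiplier algebra of H2, the
   multiplier norm being the operator norm of the multiplication operator *)
Definition schur (H2 : rkhs szego_kernel) b :=
  exists2 M : bop H2 H2,
    (forall f z, rkhs_eval H2 (M f) z = b z (rkhs_eval H2 f z)) & `|M| <= 1.

Definition herglotz (T : bop H H) : bop H H := binv (bid H - T) \bo (bid H + T).

(* mu = mu_b *)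
Definition clark_map b (mu : LF -> bop H H) :=
  [/\ forall z, invertible (bid H - b z),
      completely_positive (opSS R d) mu &
      forall z w : ball, mu (resolvent_star z \bo resolvent w) =
        (2^-1 / (1 - rowprod (sval z) (sval w))) *:
          (herglotz (b z) + adj (herglotz (b w)))].

(* The completion of S (x) H modulo null vectors: a Hilbert space with a
   bilinear map from S x H which realizes the pre-inner product and whose
   values span a dense subspace. The map is only considered on S. *)
Record P2 (mu : LF -> bop H H) := MkP2 {
  P2_space :> hilbertType R;
  P2_tensor : LF -> H -> P2_space;
  P2_tensor_linear : forall p, opS R d p -> linear (P2_tensor p);
  P2_tensor_linearl : forall a p q h, opS R d p -> opS R d q ->
    P2_tensor (a *: p + q) h = a *: P2_tensor p h + P2_tensor q h;
  P2_tensor_ip : forall p q h g, opS R d p -> opS R d q ->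
    ip (P2_tensor p h) (P2_tensor q g) = ip h (mu (adj p \bo q) g);
  P2_tensor_dense :
    dense (lspan [set P2_tensor p h | p in opS R d & h in [set: H]])
}.

End DeBrangesRovnyak.

Arguments szego_kernel R d H z w : clear implicits.

(* Main.v *)
Require Import Defs.
From HB Require Import structures.
From mathcomp Require Import all_boot all_order all_algebra.
From mathcomp Require Import all_classical all_reals all_analysis.
From mathcomp Require Import complex ring lra.

Set Implicit Arguments.
Unset Strict Implicit.
Unset Printing Implicit Defensive.

Import Order.TTheory GRing.Theory Num.Theory.
Import numFieldNormedType.Exports.

Local Open Scope classical_set_scope.
Local Open Scope ring_scope.
Local Notation "x %:C" := (real_complex _ x) : ring_scope.

(** Write R_w for the resolvent (I - Lw^* )^-1 and k_(w,h) for the element of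
    K = K(b) that reproduces the values at w in the direction h. The idea is to
    recognize the kernel functions of K inside P = P^2(mu). Put
    v_(w,h) = R_w (x) (I - b(w))^* h. Its inner products are
      <v_(z,g), v_(w,h)> = <g, (I - b(z)) mu(R_z^* R_w) (I - b(w))^* h>,
    and since mu(R_z^* R_w) is half the Herglotz sum H_b(z) + H_b(w)^* divided
    by 1 - z w^*, the operator identity
      (I - b(z)) (H_b(z) + H_b(w)^* ) (I - b(w))^* = 2 (I - b(z) b(w)^* )
    ([herglotz_sum_adj]) says that they are the values <g, k^b(z, w) h> of the
    kernel of K, that is <k_(z,g), k_(w,h)>. Two families with the same Gram
    matrix, the first one total, are related by an isometry U : P -> K
    ([gram_isometry]).

    Everything else follows from the identity
      <g, (U x)(z)> = <k_(z,g), U x> = <U v_(z,g), U x> = <v_(z,g), x>.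
    At x = p (x) h its right side is <g, (I - b(z)) mu(R_z^* p) h>, which is the
    required formula, for all p in S at once. For y in K, it shows that
    U (U^* y) and y take the same values, so U is onto. An operator satisfying
    the formula is determined on the dense span of the p (x) h.

    The family v is total ([dense_resolvent_tensor]) because I - b(w)^* is onto,
    the resolvents span a dense subspace of S, and |p (x) h| <= |p| |1 (x) h|.
    The last bound is the positivity of mu at |p|^2 - p^* p, which makes sense
    because p^* p lies in the closure of S + S^* ([adj_opS_opS]); that in turn
    comes from the identity
      R_z^* R_w = (1 - z w^* )^-1 (R_z^* + R_w - I)
    of [resolvent_product].

    Adjoints are provided by the Riesz representation theorem ([riesz]) and the
    resolvents by the invertibility of I - T for a strict contraction T
    ([invertible_sub_contraction]). *)

(** * Norms, approximation and completeness *)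

Section RealNorm.
Variable R : realType.
Implicit Types U V W : normedModType R[i].

(** The norm takes values in the complex numbers, where the order is partial;
    its real part carries the same information and lives in an ordered field. *)
Definition rnorm V (x : V) : R := complex.Re `|x|.

Lemma rnormE V (x : V) : (rnorm x)%:C = `|x|.
Proof. exact: Re_normK. Qed.

Lemma rnorm_ge0 V (x : V) : 0 <= rnorm x.
Proof. by rewrite -ler0c rnormE. Qed.

Lemma rnormD V (x y : V) : rnorm (x + y) <= rnorm x + rnorm y.
Proof. by rewrite -lecR rmorphD /= !rnormE ler_normD. Qed.

Lemma rnormN V (x : V) : rnorm (- x) = rnorm x.
Proof. by rewrite /rnorm normrN. Qed.

Lemma rnormB V (x y : V) : rnorm (x - y) = rnorm (y - x).
Proof. by rewrite -rnormN opprB. Qed.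

Lemma Re_le_norm (a : R[i]) : complex.Re a <= complex.Re `|a|.
Proof.
rewrite (le_trans (ler_norm _))// -lecR RRe_real ?normr_real//.
exact: normc_ge_Re.
Qed.

Lemma Re_norm_ge0 (a : R[i]) : 0 <= complex.Re `|a|.
Proof. by rewrite -ler0c RRe_real ?normr_real. Qed.

Lemma rnormZ V (a : R[i]) (x : V) : rnorm (a *: x) = complex.Re `|a| * rnorm x.
Proof. by apply: complexI; rewrite rmorphM /= !rnormE normrZ. Qed.

Lemma rnorm0 V : rnorm (0 : V) = 0.
Proof. by rewrite /rnorm normr0. Qed.

Lemma rnorm_eq0 V (x : V) : rnorm x <= 0 -> x = 0.
Proof. by rewrite -lecR rnormE normr_le0 => /eqP. Qed.

Lemma rnorm_triangle V (x y z : V) : rnorm (x - z) <= rnorm (x - y) + rnorm (y - z).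
Proof. by rewrite (le_trans _ (rnormD _ _))// addrA subrK. Qed.

Lemma closure_rnormP V (A : set V) x :
  closure A x <-> forall e : R, 0 < e -> exists2 y, A y & rnorm (x - y) < e.
Proof.
split=> [Ax e e0|Ax B /nbhs_ballP[e /= e0 xB]].
  have e0' : 0 < e%:C :> R[i] by rewrite ltcR.
  have [y [Ay]] := Ax _ (nbhsx_ballx x _ e0').
  by rewrite -ball_normE /= -rnormE ltcR => ?; exists y.
have eE : e = (complex.Re e)%:C by rewrite RRe_real ?gtr0_real.
have [|y Ay xy] := Ax (complex.Re e); first by rewrite -ltcR -eE.
by exists y; split=> //; apply: xB; rewrite -ball_normE /= -rnormE eE ltcR.
Qed.

Lemma dense_rnormP V (A : set V) : dense A ->
  forall x (e : R), 0 < e -> exists2 y, A y & rnorm (x - y) < e.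
Proof.
move=> dA x; apply/closure_rnormP => B /nbhs_ballP[e /= e0 xB].
have := dA _ _ (ball_open x e).
case; first by exists x; exact: ballxx.
by move=> y [xy Ay]; exists y; split=> //; exact: xB.
Qed.

Lemma opnormP V W (T : bop V W) x : rnorm (T x) <= opnorm T * rnorm x.
Proof. by rewrite -lecR rmorphM /= !rnormE opnorm_le. Qed.

Lemma rnorm_bop V W (T : bop V W) : rnorm T = opnorm T.
Proof. by apply: complexI; rewrite rnormE. Qed.

Lemma rnorm_bop_le V W (T : bop V W) (c : R) : 0 <= c ->
  (forall x, rnorm (T x) <= c * rnorm x) -> rnorm T <= c.
Proof.
move=> c0 Tc; rewrite rnorm_bop le_opnorm// => x.
by rewrite -!rnormE -rmorphM lecR.
Qed.

Lemma bounded_bop V W (f : V -> W) (c : R) : linear f ->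
  (forall x, rnorm (f x) <= c * rnorm x) -> exists T : bop V W, T = f :> (V -> W).
Proof.
move=> lf fc.
pose lfm := GRing.isLinear.Build R[i] V W _ f lf.
pose g : {linear V -> W} := HB.pack f lfm.
have fP : f \in @bop_pred R V W.
  apply/asboolP; split=> //.
  have ag : (f : V -> W) = g by [].
  rewrite ag; apply/linear_bounded_continuous/linear_boundedP.
  apply: (@filterS _ _ _ (fun r : R[i] => c%:C <= r)); last first.
    by apply: nbhs_pinfty_ge; rewrite complex_real.
  move=> r cr x; rewrite -!rnormE /= (le_trans (y := (c * rnorm x)%:C)) ?lecR ?fc//.
  by rewrite rmorphM /= ler_wpM2r// ler0c rnorm_ge0.
by exists (Bop fP).
Qed.

Lemma bopP V W (S T : bop V W) : (forall x, S x = T x) -> S = T.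
Proof. by move=> ST; apply/val_inj/funext. Qed.

Lemma bop_add V W (T : bop V W) x y : T (x + y) = T x + T y.
Proof. exact: linearD. Qed.
Lemma bop_sub V W (T : bop V W) x y : T (x - y) = T x - T y.
Proof. exact: linearB. Qed.
Lemma bop_scale V W (T : bop V W) a x : T (a *: x) = a *: T x.
Proof. exact: linearZ. Qed.
Lemma bopDE V W (S T : bop V W) x : (S + T) x = S x + T x. Proof. by []. Qed.
Lemma bopNE V W (S : bop V W) x : (- S) x = - S x. Proof. by []. Qed.
Lemma bopZE V W a (S : bop V W) x : (a *: S) x = a *: S x. Proof. by []. Qed.
Lemma bop0E V W x : (0 : bop V W) x = 0. Proof. by []. Qed.
Lemma bcompE U V W (S : bop V W) (T : bop U V) x : (S \bo T) x = S (T x).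
Proof. by []. Qed.
Lemma bidE V x : bid V x = x. Proof. by []. Qed.

Lemma bop_sumE V W I (r : seq I) (F : I -> bop V W) (x : V) :
  (\sum_(i <- r) F i) x = \sum_(i <- r) F i x.
Proof. by elim/big_rec2: _ => // i y T _ <-. Qed.

End RealNorm.

Section Completeness.
Variables (R : realType) (V : completeNormedModType R[i]).

(** Cantor's intersection argument, in a form that asks nothing of the sets
    but that they be nonempty, nested and of small diameter: they shrink to a
    point. The Riesz vector, the solution of x - T x = y and the values of an
    isometric extension are all obtained as such a point, the sets being those
    of the approximate solutions. *)
Lemma nested_approx (A : R -> set V) :
  (forall e, 0 < e -> exists x, A e x) ->
  (forall e e', e <= e' -> A e `<=` A e') ->
  (forall e, 0 < e -> exists2 t, 0 < t &
    forall x y, A t x -> A t y -> rnorm (x - y) < e) ->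
  exists y, forall e, 0 < e -> exists2 x, A e x & rnorm (y - x) < e.
Proof.
move=> A0 Ale Adiam.
pose FF := filter_from [set e : R | 0 < e] A.
have PF : ProperFilter FF.
  apply: filter_from_proper; last by move=> e /= /A0.
  apply: filter_from_filter; first by exists 1 => /=.
  move=> e e' /= e0 e'0; exists (Num.min e e'); first by rewrite /= lt_min e0.
  by move=> x Ax; split; apply: Ale Ax; rewrite ge_min lexx ?orbT.
have FC : cauchy FF.
  apply/cauchy_ballP => e e0.
  have eE : e = (complex.Re e)%:C by rewrite RRe_real ?gtr0_real.
  have [|t t0 At] := Adiam (complex.Re e); first by rewrite -ltcR -eE.
  exists (A t, A t); first by split; exists t.
  move=> [x y] /= [Ax Ay].
  by rewrite -ball_normE /ball_/= -rnormE eE ltcR; exact: At.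
have /cvg_ex[y Fy] := @cauchy_cvg V FF PF FC.
exists y => e e0.
have e0' : 0 < e%:C :> R[i] by rewrite ltcR.
have := Fy _ (nbhsx_ballx y _ e0'); case=> t /= t0 At.
have := A0 (Num.min e t); rewrite lt_min e0 t0 => /(_ isT)[x Ax]; exists x.
  by apply: Ale Ax; rewrite ge_min lexx.
have : A t x by apply: Ale Ax; rewrite ge_min lexx orbT.
by move=> /At; rewrite -ball_normE /= -rnormE ltcR.
Qed.

End Completeness.

(** * Inner products *)

Section InnerProduct.
Variable R : realType.
Implicit Types V W : hilbertType R.

Lemma ipC V (x y : V) : ip y x = (ip x y)^*.
Proof. exact: ip_conj. Qed.

Lemma ipDr V (x y z : V) : ip x (y + z) = ip x y + ip x z.
Proof. exact: (preipD (@ip_scalar R V)). Qed.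

Lemma ipZr V (x : V) a y : ip x (a *: y) = a * ip x y.
Proof. exact: (preipZ (@ip_scalar R V)). Qed.

Lemma ipDl V (x y z : V) : ip (x + y) z = ip x z + ip y z.
Proof. exact: (preipDl (@ip_scalar R V) (@ip_conj R V)). Qed.

Lemma ipZl V a (x y : V) : ip (a *: x) y = a^* * ip x y.
Proof. exact: (preipZl (@ip_scalar R V) (@ip_conj R V)). Qed.

Lemma ip0r V (x : V) : ip x 0 = 0.
Proof. exact: (preip0 (@ip_scalar R V)). Qed.

Lemma ipNr V (x y : V) : ip x (- y) = - ip x y.
Proof. by rewrite -scaleN1r ipZr mulN1r. Qed.

Lemma ipNl V (x y : V) : ip (- x) y = - ip x y.
Proof. by rewrite ipC ipNr rmorphN /= -ipC. Qed.

Lemma ipBr V (x y z : V) : ip x (y - z) = ip x y - ip x z.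
Proof. by rewrite ipDr ipNr. Qed.

Lemma ipBl V (x y z : V) : ip (x - y) z = ip x z - ip y z.
Proof. by rewrite ipDl ipNl. Qed.

Lemma ip_sumr V I (r : seq I) (x : V) (F : I -> V) :
  ip x (\sum_(i <- r) F i) = \sum_(i <- r) ip x (F i).
Proof. by apply: big_morph; [exact: ipDr|exact: ip0r]. Qed.

Lemma ip_suml V I (r : seq I) (x : V) (F : I -> V) :
  ip (\sum_(i <- r) F i) x = \sum_(i <- r) ip (F i) x.
Proof.
by rewrite ipC ip_sumr rmorph_sum; apply: eq_bigr => i _; rewrite /= -ipC.
Qed.

Lemma ip_rnorm V (x : V) : ip x x = (rnorm x ^+ 2)%:C.
Proof. by rewrite ip_norm -rnormE rmorphXn. Qed.

Lemma ip_CauchySchwarz V (x y : V) : complex.Re `|ip x y| <= rnorm x * rnorm y.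
Proof.
rewrite -lecR RRe_real ?normr_real// rmorphM /= !rnormE.
rewrite -(@ler_pXn2r _ 2)// ?nnegrE ?mulr_ge0// exprMn -!ip_norm.
apply: (preip_CauchySchwarz (@ip_scalar R V) (@ip_conj R V)) => z.
  by rewrite ip_norm exprn_ge0.
by move/eqP; rewrite ip_norm sqrf_eq0 normr_eq0 => /eqP.
Qed.

Lemma ip_injr V (x y : V) : (forall z, ip z x = ip z y) -> x = y.
Proof.
move=> xy; apply/subr0_eq/rnorm_eq0.
have := ip_rnorm (x - y); rewrite ipBr !xy subrr => /esym/complexI/eqP.
by rewrite sqrf_eq0 => /eqP ->.
Qed.

Lemma rnormD_sqr V (x y : V) :
  rnorm (x + y) ^+ 2 = rnorm x ^+ 2 + 2 * complex.Re (ip x y) + rnorm y ^+ 2.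
Proof.
apply: complexI; rewrite -ip_rnorm ipDr !ipDl !ip_rnorm (ipC x y).
case: (ip x y) => u v; apply/eqP; rewrite eq_complex /=.
by apply/andP; split; apply/eqP; ring.
Qed.

End InnerProduct.

(** * The Riesz representation theorem *)

Section Riesz.
Variables (R : realType) (V : hilbertType R) (phi : V -> R[i]) (c : R).
Hypothesis phi_scalar : scalar phi.
Hypothesis c_ge0 : 0 <= c.
Hypothesis phi_le : forall x, complex.Re `|phi x| <= c * rnorm x.

Let psi x : R := complex.Re (phi x).

Let phi0 : phi 0 = 0.
Proof.
have := phi_scalar 1 0 0; rewrite scale1r addr0 mul1r.
by move=> /(congr1 (fun t => t - phi 0)); rewrite addrK subrr => <-.
Qed.

Let phiZ a x : phi (a *: x) = a * phi x.
Proof. by rewrite -[a *: x]addr0 phi_scalar phi0 addr0. Qed.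

Let psiDZ (s : R) x y : psi (x + s%:C *: y) = psi x + s * psi y.
Proof.
rewrite /psi addrC phi_scalar; case: (phi x) (phi y) => u v [u' v'] /=; ring.
Qed.

Let J x : R := rnorm x ^+ 2 - 2 * psi x.

Let JDZ x (s : R) v : J (x + s%:C *: v) =
  J x + 2 * s * (complex.Re (ip x v) - psi v) + s ^+ 2 * rnorm v ^+ 2.
Proof.
rewrite /J psiDZ rnormD_sqr ipZr rnormZ.
have -> : complex.Re `|s%:C : R[i]| = `|s| by rewrite normc_def /= expr0n addr0 sqrtr_sqr.
rewrite exprMn real_normK ?num_real//.
by case: (ip x v) => a b /=; ring.
Qed.

Let J_ge x : - c ^+ 2 <= J x.
Proof.
have h1 : psi x <= c * rnorm x by apply: le_trans (phi_le x); exact: Re_le_norm.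
have := sqr_ge0 (rnorm x - c); rewrite /J; nra.
Qed.

Let m := inf (range J).

Let J_inf : has_inf (range J).
Proof.
split; first by exists (J 0), 0.
by exists (- c ^+ 2) => _ [x _ <-]; exact: J_ge.
Qed.

Let m_le x : m <= J x.
Proof. by apply: ge_inf; [case: J_inf|exists x]. Qed.

Let parallelogram x y :
  rnorm (x - y) ^+ 2 = 2 * (J x + J y) - 4 * J (x + (2^-1)%:C *: (y - x)).
Proof.
have yE : y = x + 1%:C *: (y - x) by rewrite scale1r addrC subrK.
rewrite [X in _ + J X]yE !JDZ rnormB.
by field.
Qed.

(** The vector representing phi is the minimizer of J x = |x|^2 - 2 Re (phi x),
    whose first variation at y in the direction v is 2 Re (<y, v> - phi v).
    Near-minimizers are close to each other by the parallelogram law, so that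
    their sets shrink to a point. *)
Lemma riesz : exists y, forall x, phi x = ip y x.
Proof.
have [||e e0|y yA] := @nested_approx R V (fun e => [set x | J x < m + e]).
- move=> e e0; have [_ [x _ <-] Jx] := inf_adherent e0 J_inf.
  by exists x.
- by move=> t t' tt' x /= Jx; apply: lt_le_trans Jx _; rewrite lerD2l.
- exists (e ^+ 2 / 4); first by rewrite divr_gt0// exprn_gt0.
  move=> x z /= Jx Jz; rewrite -(@ltr_pXn2r _ 2)// ?nnegrE ?rnorm_ge0 ?(ltW e0)//.
  by rewrite parallelogram; have := m_le (x + (2^-1)%:C *: (z - x)); lra.
have key v : psi v <= complex.Re (ip y v).
  rewrite leNgt; apply/negP => lt_v.
  (* If D > 0, moving a near-minimizer by s v changes J by about
     - 2 s D + s^2 n^2; with J within s^2 of its infimum, this s is small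
     enough to make the change exceed the margin. *)
  have n0 := rnorm_ge0 v; set n := rnorm v in n0 *.
  have [D DE D0] : exists2 D, D = psi v - complex.Re (ip y v) & 0 < D.
    by exists (psi v - complex.Re (ip y v)) => //; rewrite subr_gt0.
  have q0 : 0 < (1 + n) ^+ 2 by rewrite exprn_gt0// ltr_wpDr.
  have Dq0 : 0 < D + (1 + n) ^+ 2 by apply: addr_gt0.
  pose s := D / (D + (1 + n) ^+ 2).
  have s0 : 0 < s by rewrite divr_gt0.
  have s1 : s <= 1 by rewrite /s ler_pdivrMr// mul1r lerDl ltW.
  have sD : s * (1 + n) ^+ 2 <= D.
    by rewrite /s mulrAC ler_pdivrMr// ler_pM2l// lerDr ltW.
  clearbody s.
  have [x /= Jx xy] := yA (s ^+ 2) (exprn_gt0 _ s0).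
  have := m_le (x + s%:C *: v); rewrite JDZ => mx.
  have Rxy : complex.Re (ip x v) <= complex.Re (ip y v) + s ^+ 2 * n.
    have : complex.Re (ip (x - y) v) <= s ^+ 2 * n.
      apply: le_trans (Re_le_norm _) _; apply: le_trans (ip_CauchySchwarz _ _) _.
      by rewrite ler_wpM2r// rnormB ltW.
    by rewrite ipBl raddfB /= => h; lra.
  have h1 : 0 < s ^+ 2 + 2 * s * (s ^+ 2 * n - D) + s ^+ 2 * n ^+ 2.
    apply: lt_le_trans (_ : J x + 2 * s * (complex.Re (ip x v) - psi v)
      + s ^+ 2 * n ^+ 2 - J x + s ^+ 2 <= _); first by lra.
    have : 2 * s * (complex.Re (ip x v) - psi v) <= 2 * s * (s ^+ 2 * n - D).
      by rewrite ler_pM2l ?mulr_gt0// DE; lra.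
    by lra.
  have h2 : s * (s + 2 * (s ^+ 2 * n - D) + s * n ^+ 2) =
    s ^+ 2 + 2 * s * (s ^+ 2 * n - D) + s ^+ 2 * n ^+ 2 by ring.
  move: h1; rewrite -h2 pmulr_rgt0// => h1.
  have h3 : s ^+ 2 * n <= s * n by rewrite ler_wpM2r// expr2 ler_piMr// ltW.
  have h4 : s * (1 + n) ^+ 2 = s + 2 * (s * n) + s * n ^+ 2 by ring.
  by lra.
have keyE v : complex.Re (phi v) = complex.Re (ip y v).
  apply/eqP; rewrite eq_le key/=; have := key (- v).
  by rewrite /psi -scaleN1r phiZ ipZr !mulN1r !raddfN /= lerN2.
(* The imaginary part of phi x is minus the real part of phi (i x). *)
exists y => x; have := keyE x; have := keyE ((0 +i* 1)%C *: x).
rewrite ipZr phiZ; case: (phi x) (ip y x) => u v [u' v'] /= E ->.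
by congr Complex; lra.
Qed.
End Riesz.

(** * Adjoints and inverses *)

Section Adjoint.
Variable R : realType.
Implicit Types U V W : hilbertType R.

Let le_of_sqr_le (a c : R) : 0 <= a -> 0 <= c -> a ^+ 2 <= c * a -> a <= c.
Proof. by move=> a0 c0 ac; rewrite leNgt; apply/negP => ca; nra. Qed.

(** Riesz representation of x |-> <y, T x> produces the adjoint at y, so that
    the default value in the definition of [adj] is never taken. *)
Lemma adjP V W (T : bop V W) x y : ip (T x) y = ip x (adj T y).
Proof.
suff [S SP] : exists S : bop W V, forall x y, ip (T x) y = ip x (S y).
  rewrite /adj; case: xgetP => [S' _ S'P|/(_ S)]; first exact: S'P.
  by move=> /(_ SP).
have /choice[S SP] : forall y, exists z, forall x, ip y (T x) = ip z x.
  move=> z; apply: (@riesz _ _ _ (rnorm z * opnorm T)).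
  - by move=> a u v; rewrite !linearP ipDr ipZr.
  move=> u; rewrite (le_trans (ip_CauchySchwarz _ _))// -mulrA ler_wpM2l ?rnorm_ge0//.
  exact: opnormP.
have SP' u v : ip (T u) v = ip u (S v) by rewrite ipC SP -ipC.
have Sl : linear S.
  by move=> a u v; apply: ip_injr => z; rewrite -SP' !(ipDr, ipZr) -!SP'.
have [|S' S'E] := bounded_bop (c := opnorm T) Sl.
  move=> z; apply: le_of_sqr_le; rewrite ?mulr_ge0 ?rnorm_ge0 ?opnorm_ge0//.
  have -> : rnorm (S z) ^+ 2 = complex.Re (ip z (T (S z))) by rewrite SP ip_rnorm.
  apply: le_trans (Re_le_norm _) _; apply: le_trans (ip_CauchySchwarz _ _) _.
  by rewrite mulrC mulrAC ler_wpM2r ?rnorm_ge0// opnormP.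
by exists S' => u v; rewrite S'E.
Qed.

Lemma adjPr V W (T : bop V W) x y : ip (adj T x) y = ip x (T y).
Proof. by rewrite ipC -adjP -ipC. Qed.

Lemma adj_eq V W (T : bop V W) (S : bop W V) :
  (forall x y, ip (T x) y = ip x (S y)) -> adj T = S.
Proof. by move=> TS; apply: bopP => y; apply: ip_injr => x; rewrite -adjP. Qed.

Lemma adjK V W (T : bop V W) : adj (adj T) = T.
Proof. by apply: adj_eq => x y; rewrite adjPr. Qed.

Lemma adj_conj_linear V W a (S T : bop V W) : adj (a *: S + T) = a^* *: adj S + adj T.
Proof.
by apply: adj_eq => x y; rewrite !(bopDE, bopZE, ipDl, ipDr, ipZl, ipZr) !adjP.
Qed.

Lemma adj0 V W : adj (0 : bop V W) = 0.
Proof. by apply: adj_eq => x y; rewrite !bop0E ip0r ipC ip0r rmorph0. Qed.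

Lemma adj_add V W (S T : bop V W) : adj (S + T) = adj S + adj T.
Proof. by rewrite -[S]scale1r adj_conj_linear rmorph1 !scale1r. Qed.

Lemma adj_scale V W a (T : bop V W) : adj (a *: T) = a^* *: adj T.
Proof. by rewrite -[a *: T]addr0 adj_conj_linear adj0 addr0. Qed.

Lemma adj_sub V W (S T : bop V W) : adj (S - T) = adj S - adj T.
Proof. by rewrite adj_add -[- T]scaleN1r adj_scale rmorphN1 scaleN1r. Qed.

Lemma adj_sum V W I (r : seq I) (F : I -> bop V W) :
  adj (\sum_(i <- r) F i) = \sum_(i <- r) adj (F i).
Proof. by apply: big_morph; [exact: adj_add|exact: adj0]. Qed.

Lemma adj_bid V : adj (bid V) = bid V.
Proof. by apply: adj_eq. Qed.

Lemma adj_comp U V W (S : bop V W) (T : bop U V) : adj (S \bo T) = adj T \bo adj S.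
Proof. by apply: adj_eq => x y; rewrite !bcompE !adjP. Qed.

Lemma rnorm_adj V W (T : bop V W) : rnorm (adj T) = rnorm T.
Proof.
have le V' W' (S : bop V' W') : rnorm (adj S) <= rnorm S.
  apply: rnorm_bop_le => [|x]; first exact: rnorm_ge0.
  apply: le_of_sqr_le; rewrite ?mulr_ge0 ?rnorm_ge0//.
  have -> : rnorm (adj S x) ^+ 2 = complex.Re (ip x (S (adj S x))).
    by rewrite -adjPr ip_rnorm.
  apply: le_trans (Re_le_norm _) _; apply: le_trans (ip_CauchySchwarz _ _) _.
  by rewrite mulrC mulrAC ler_wpM2r ?rnorm_ge0// rnorm_bop opnormP.
by apply/eqP; rewrite eq_le le -{1}[T]adjK le.
Qed.

Lemma rnorm_comp U V W (S : bop V W) (T : bop U V) :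
  rnorm (S \bo T) <= rnorm S * rnorm T.
Proof.
apply: rnorm_bop_le => [|x]; first by rewrite mulr_ge0 ?rnorm_ge0.
rewrite !rnorm_bop -mulrA; apply: le_trans (opnormP S (T x)) _.
by rewrite ler_wpM2l ?opnorm_ge0// opnormP.
Qed.

End Adjoint.

Section Inverse.
Variable R : realType.
Implicit Types V W : hilbertType R.

Lemma inverse_of_unique V W (T : bop V W) (S S' : bop W V) :
  inverse_of T S -> inverse_of T S' -> S = S'.
Proof.
move=> [ST TS] [S'T TS']; apply: bopP => x.
have := congr1 (fun f : bop W W => S (f x)) TS'; rewrite !bcompE !bidE => <-.
by have := congr1 (fun f : bop V V => f (S' x)) ST; rewrite !bcompE !bidE.
Qed.

Lemma binv_eq V W (T : bop V W) (S : bop W V) : inverse_of T S -> binv T = S.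
Proof.
rewrite /binv => TS; case: xgetP => [S' _ /inverse_of_unique|/(_ S)//]; exact.
Qed.

Lemma binvP V W (T : bop V W) : invertible T -> inverse_of T (binv T).
Proof. by move=> [S TS]; rewrite (binv_eq TS). Qed.

Lemma binvK V W (T : bop V W) x : invertible T -> binv T (T x) = x.
Proof. by move=> /binvP[+ _] => /(congr1 (fun f : bop V V => f x)). Qed.

Lemma binvKr V W (T : bop V W) x : invertible T -> T (binv T x) = x.
Proof. by move=> /binvP[_ +] => /(congr1 (fun f : bop W W => f x)). Qed.

Lemma inverse_of_adj V W (T : bop V W) (S : bop W V) :
  inverse_of T S -> inverse_of (adj T) (adj S).
Proof. by move=> [ST TS]; split; rewrite -adj_comp ?TS ?ST adj_bid. Qed.

Lemma binv_adj V W (T : bop V W) : invertible T -> binv (adj T) = adj (binv T).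
Proof. by move=> /binvP/inverse_of_adj/binv_eq. Qed.

(** The equation x - T x = y is solved by iterating x |-> T x + y, which
    multiplies the residual by at most r; since |x - T x| >= (1 - r) |x|,
    vectors of small residual are close together, and the inverse is bounded. *)
Lemma invertible_sub_contraction V (T : bop V V) (r : R) : 0 <= r < 1 ->
  (forall x, rnorm (T x) <= r * rnorm x) -> invertible (bid V - T).
Proof.
move=> /andP[r0 r1] Tr.
have lower x : (1 - r) * rnorm x <= rnorm (x - T x).
  have := rnorm_triangle x (T x) 0; rewrite !subr0; have := Tr x; lra.
have subTE u v : u - v - T (u - v) = (u - T u) - (v - T v).
  by rewrite linearB !opprD !opprK addrACA.
have r1' : 0 < 1 - r by rewrite subr_gt0.
have surj y : exists x, x - T x = y.
  have [||e e0|x xA] := @nested_approx R V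
      (fun e => [set x | rnorm (x - T x - y) < e]).
  - move=> e e0.
    have iterT n : exists x, rnorm (x - T x - y) <= r ^+ n * rnorm y.
      elim: n => [|n [x xn]].
        by exists 0; rewrite linear0 !sub0r oppr0 add0r rnormN mul1r.
      exists (T x + y).
      have -> : T x + y - T (T x + y) - y = T (x - T x - y).
        by rewrite addrAC addrK linearD !linearB opprD addrA.
      by rewrite (le_trans (Tr _))// exprS -mulrA ler_wpM2l.
    have rn : (fun n => r ^+ n * rnorm y) @ \oo --> (0 : R).
      rewrite -[X in _ --> X](mul0r (rnorm y)); apply: cvgMl.
      by apply: cvg_expr; rewrite ger0_norm.
    have [n _ /(_ n (leqnn n)) rne] := cvgr_lt (0 : R) rn e e0.
    by have [x xn] := iterT n; exists x; exact: le_lt_trans rne.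
  - by move=> t t' tt' x /= xt; apply: lt_le_trans tt'.
  - exists ((1 - r) * e / 2); first by rewrite divr_gt0// mulr_gt0.
    move=> u v /= ut vt; rewrite -(ltr_pM2l r1'); apply: le_lt_trans (lower _) _.
    have -> : u - v - T (u - v) = (u - T u - y) - (v - T v - y).
      by rewrite subTE [- (v - T v - y)]opprB addrA subrK.
    apply: le_lt_trans (rnormD _ _) _; rewrite rnormN; lra.
  exists x; apply/subr0_eq/rnorm_eq0/ler_addgt0Pl => e e0; rewrite addr0.
  have [|u /= ue xu] := xA (e / 3); first by rewrite divr_gt0.
  have -> : x - T x - y = (x - u) + (u - T u - y) + T (u - x).
    by rewrite linearB [x - u + _]addrA [x - u + (u - _)]addrA subrK
      [RHS]addrAC [x - T u + _]addrA subrK.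
  apply: le_trans (rnormD _ _) _.
  have := rnormD (x - u) (u - T u - y); have := Tr (u - x).
  rewrite (rnormB u x); nra.
have /choice[S SP] := surj.
have inj x y : x - T x = y - T y -> x = y.
  move=> xy; apply/subr0_eq/rnorm_eq0.
  by have := lower (x - y); rewrite subTE xy subrr rnorm0 pmulr_rle0.
have Sl : linear S.
  by move=> a x y; apply: inj; rewrite SP linearP opprD addrACA -scalerBr !SP.
have [|S' S'E] := bounded_bop (c := (1 - r)^-1) Sl.
  by move=> x; rewrite mulrC ler_pdivlMr// mulrC (le_trans (lower _))// SP.
exists S'; split; apply: bopP => x; rewrite bcompE S'E !(bopDE, bopNE, bidE) ?SP//.
by apply: inj; rewrite SP.
Qed.

End Inverse.

(** * Subspaces and isometric extension *)

Section Subspaces.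

Definition lsubspace (K : pzRingType) (V : lmodType K) (A : set V) :=
  A 0 /\ forall a x y, A x -> A y -> A (a *: x + y).

Lemma lsubspace_sum (K : pzRingType) (V : lmodType K) (A : set V) n
    (c : 'I_n -> K) (x : 'I_n -> V) :
  lsubspace A -> (forall i, A (x i)) -> A (\sum_i c i *: x i).
Proof.
move=> [A0 AP] Ax; elim/big_rec: _ => // i y _ Ay; exact: AP.
Qed.

Lemma lspan_min (K : pzRingType) (V : lmodType K) (A B : set V) :
  lsubspace B -> A `<=` B -> lspan A `<=` B.
Proof.
by move=> sB AB _ [n [c [x [Ax ->]]]]; apply: lsubspace_sum => // i; exact/AB.
Qed.

Lemma sub_lspan (K : pzRingType) (V : lmodType K) (A : set V) : A `<=` lspan A.
Proof.
move=> x Ax; exists 1%N, (fun=> 1), (fun=> x); split=> //.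
by rewrite big_ord1 scale1r.
Qed.

Lemma lsubspace_lspan (K : pzRingType) (V : lmodType K) (A : set V) : lsubspace (lspan A).
Proof.
split; first by exists 0%N, (fun=> 0), (fun=> 0); split=> [[]//|]; rewrite big_ord0.
move=> a _ _ [n [c [x [Ax ->]]]] [m [e [y [Ay ->]]]].
exists (n + m)%N, (fun i => match fintype.split i with inl j => a * c j | inr j => e j end),
  (fun i => match fintype.split i with inl j => x j | inr j => y j end).
split; first by move=> i; case: (fintype.split i).
rewrite big_split_ord scaler_sumr; congr (_ + _); apply: eq_bigr => i _.
  by rewrite (unsplitK (inl i)) scalerA.
by rewrite (unsplitK (inr i)).
Qed.

Lemma lsubspace_closure (R : realType) (V : normedModType R[i]) (A : set V) :
  lsubspace A -> lsubspace (closure A).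
Proof.
move=> [A0 AP]; split; first exact: subset_closure.
move=> a x y /closure_rnormP Ax /closure_rnormP Ay; apply/closure_rnormP => e e0.
have a0 : 0 <= complex.Re `|a| by exact: Re_norm_ge0.
have [|x' Ax' xx'] := Ax (e / 2 / (complex.Re `|a| + 1)).
  by rewrite !divr_gt0// ltr_wpDl.
have [|y' Ay' yy'] := Ay (e / 2); first by rewrite divr_gt0.
exists (a *: x' + y'); first exact: AP.
rewrite opprD addrACA -scalerBr (le_lt_trans (rnormD _ _))// rnormZ.
move: xx'; rewrite ltr_pdivlMr; last by rewrite ltr_wpDl.
have := rnorm_ge0 (x - x'); nra.
Qed.

Lemma closure_lipschitz (R : realType) (V W : normedModType R[i]) (f : V -> W) (c : R)
    (A : set V) (B : set W) : (forall x y, rnorm (f x - f y) <= c * rnorm (x - y)) ->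
  (forall x, A x -> B (f x)) -> forall x, closure A x -> closure B (f x).
Proof.
move=> fc AB x /closure_rnormP Ax; apply/closure_rnormP => e e0.
have c1 : 0 < `|c| + 1 by rewrite ltr_wpDl.
have [|y Ay xy] := Ax (e / (`|c| + 1)); first by rewrite divr_gt0.
exists (f y); first exact: AB.
apply: le_lt_trans (fc _ _) _; move: xy; rewrite ltr_pdivlMr//.
have := ler_norm c; have := rnorm_ge0 (x - y); nra.
Qed.

End Subspaces.

Section GramIsometry.
Variable R : realType.
Implicit Types V W : hilbertType R.

(** Polarization: |x + y|^2 determines Re <x, y>, and replacing y by i y gives
    the imaginary part. *)
Lemma isometry_ip V W (U : bop V W) : (forall x, rnorm (U x) = rnorm x) ->
  forall x y, ip (U x) (U y) = ip x y.
Proof.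
move=> Un.
have ReE x y : complex.Re (ip (U x) (U y)) = complex.Re (ip x y).
  have := Un (x + y) => /(congr1 (fun t => t ^+ 2)).
  by rewrite linearD !rnormD_sqr !Un; lra.
move=> x y; have := ReE x y; have := ReE x ((0 +i* 1)%C *: y).
rewrite linearZ !ipZr; case: (ip (U x) (U y)) (ip x y) => u v [u' v'] /= E ->.
by congr Complex; lra.
Qed.

(** Equal Gram matrices mean that sending each combination of the v i to the
    same combination of the w i is well defined and isometric. Working with
    the closure G' of the graph G avoids choosing combinations: G' is linear,
    isometric, hence functional, and it is total because the v i span a dense
    subspace. *)
Lemma gram_isometry V W I (v : I -> V) (w : I -> W) :
  dense (lspan (range v)) -> (forall i j, ip (v i) (v j) = ip (w i) (w j)) ->
  exists2 U : bop V W, (forall x y, ip (U x) (U y) = ip x y) &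
    forall i, U (v i) = w i.
Proof.
move=> vdense gram.
pose G : set (V * W)%type := lspan (range (fun i => (v i, w i))).
have [G0 GP] : lsubspace G by exact: lsubspace_lspan.
have Gip p q : G p -> G q -> ip p.1 q.1 = ip p.2 q.2.
  move=> [n [c [x [Ax ->]]]] [m [e [y [Ay ->]]]].
  rewrite !raddf_sum !ip_sumr; apply: eq_bigr => j _.
  rewrite !ip_suml; apply: eq_bigr => i _.
  have [k _ <-] := Ax i; have [l _ <-] /= := Ay j.
  by rewrite !ipZl !ipZr gram.
have Gnorm p : G p -> rnorm p.1 = rnorm p.2.
  move=> Gp; have := Gip _ _ Gp Gp; rewrite !ip_rnorm => /complexI/eqP.
  by rewrite eqrXn2 ?rnorm_ge0// => /eqP.
pose G' x y := forall e : R, 0 < e ->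
  exists2 p, G p & rnorm (x - p.1) < e /\ rnorm (y - p.2) < e.
have total x : exists y, G' x y.
  have [||e e0|y yA] := @nested_approx R W
      (fun e => [set y | exists2 p, G p & p.2 = y /\ rnorm (x - p.1) < e]).
  - move=> e e0; have [x' x'v xx'] := dense_rnormP vdense x e0.
    have : [set x | exists y, G (x, y)] x'.
      apply: lspan_min x'v => [|_ [i _ <-]].
        split; first by exists 0.
        by move=> a y z [y' Gy] [z' Gz]; exists (a *: y' + z');
          exact: (GP a (y, y') (z, z') Gy Gz).
      by exists (w i); apply: sub_lspan; exists i.
    by move=> [y Gy]; exists y, (x', y).
  - move=> e e' ee' y [p Gp [py xp]]; exists p => //.
    by split=> //; exact: lt_le_trans ee'.
  - exists (e / 2); first by rewrite divr_gt0.
    move=> y z [p Gp [<- xp]] [q Gq [<- xq]].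
    have := GP (-1) _ _ Gq Gp => /Gnorm /=.
    rewrite !scaleN1r addrC [- q.2 + _]addrC => <-.
    have := rnorm_triangle p.1 x q.1; rewrite (rnormB p.1 x); lra.
  exists y => e e0; have [z [p Gp [<- xp]] yz] := yA e e0.
  by exists p.
have G'norm x y : G' x y -> rnorm x = rnorm y.
  move=> xy; apply/eqP; rewrite eq_le; apply/andP; split;
    apply/ler_addgt0Pl => e e0;
    have [|p /Gnorm pn [xp yp]] := xy (e / 2); rewrite ?divr_gt0//.
    have := rnorm_triangle x p.1 0; have := rnorm_triangle p.2 y 0.
    by rewrite !subr0 (rnormB _ y); lra.
  have := rnorm_triangle y p.2 0; have := rnorm_triangle p.1 x 0.
  by rewrite !subr0 (rnormB _ x); lra.
have G'P a x y x' y' : G' x y -> G' x' y' -> G' (a *: x + x') (a *: y + y').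
  move=> xy xy' e e0.
  have a0 : 0 <= complex.Re `|a| by exact: Re_norm_ge0.
  have [|p Gp [xp yp]] := xy (e / 2 / (complex.Re `|a| + 1)).
    by rewrite !divr_gt0// ltr_wpDl.
  have [|q Gq [xq yq]] := xy' (e / 2); first by rewrite divr_gt0.
  exists (a *: p + q); first exact: GP.
  rewrite /= !opprD ![_ + _ + (- _ + _)]addrACA -!scalerBr.
  move: xp yp; rewrite !ltr_pdivlMr ?ltr_wpDl// => xp yp.
  split; (apply: le_lt_trans (rnormD _ _) _; rewrite rnormZ).
    have := rnorm_ge0 (x - p.1); nra.
  have := rnorm_ge0 (y - p.2); nra.
have G'fun x y z : G' x y -> G' x z -> y = z.
  move=> xy xz; have := G'P (-1) _ _ _ _ xz xy => /G'norm.
  rewrite !scaleN1r addNr rnorm0 => /esym yz; apply/esym/eqP.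
  by rewrite -subr_eq0 -oppr_eq0 opprB addrC; apply/eqP/rnorm_eq0; rewrite yz.
have /choice[U UP] := total.
have Ul : linear U by move=> a x y; apply: G'fun (UP _) _; exact: G'P.
have [|T TE] := bounded_bop (c := 1) Ul.
  by move=> x; rewrite mul1r (G'norm _ _ (UP x)).
exists T; first by apply: isometry_ip => x; rewrite TE -(G'norm _ _ (UP x)).
move=> i; rewrite TE; apply: G'fun (UP _) _ => e e0.
exists (v i, w i); first by apply: sub_lspan; exists i.
by rewrite /= !subrr !rnorm0.
Qed.

End GramIsometry.

Section Density.
Variable R : realType.

Lemma dense_closure_lspan (V : normedModType R[i]) (A B : set V) :
  dense (lspan A) -> lsubspace B -> A `<=` closure B -> dense B.
Proof.
move=> dA sB AB; suff cB x : closure B x.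
  move=> O [x Ox] oO; have [y [By Oy]] := cB x O (open_nbhs_nbhs (conj oO Ox)).
  by exists y.
suff : closure (closure B) x by exact: closed_closure.
apply/closure_rnormP => e e0; have [y Ay xy] := dense_rnormP dA x e0.
by exists y => //; apply: lspan_min Ay => //; exact: lsubspace_closure.
Qed.

Lemma bop_dense_eq (V W : normedModType R[i]) (A : set V) (S T : bop V W) :
  dense (lspan A) -> (forall x, A x -> S x = T x) -> S = T.
Proof.
move=> dA ST; apply: bopP => x; apply/subr0_eq/rnorm_eq0/ler_addgt0Pl => e e0.
rewrite addr0 -[S x - T x]/((S - T) x).
have c0 : 0 < opnorm (S - T) + 1 by rewrite ltr_wpDl ?opnorm_ge0.
have [|y Ay] := dense_rnormP dA x (e := e / (opnorm (S - T) + 1)).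
  by rewrite divr_gt0.
rewrite ltr_pdivlMr// => xy.
have Dy : (S - T) y = 0.
  apply: (lspan_min (B := [set y | (S - T) y = 0])) Ay => [|z Az].
    split=> [|a u v Du Dv]; first exact: linear0.
    suff : (S - T) (a *: u + v) = 0 by [].
    by rewrite bop_add bop_scale Du Dv scaler0 addr0.
  suff : S z - T z = 0 by [].
    by rewrite ST// subrr.
have -> : (S - T) x = (S - T) (x - y).
  by rewrite bop_sub Dy subr0.
apply: le_trans (opnormP _ _) _.
by have := rnorm_ge0 (x - y); nra.
Qed.

End Density.

(** * The operator system generated by the resolvents *)

Section FockOperators.
Variables (R : realType) (d : nat).
Local Notation C := R[i].
Local Notation F2 := (fock R d).
Local Notation LF := (bop F2 F2).
Implicit Types (x y : F2) (z w : 'rV[C]_d).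

Lemma level_creation_pair (i j : 'I_d) (f g : seq 'I_d -> C) k :
  level k (creation_fun i f) (creation_fun j g) =
  if k is k'.+1 then level k' f ((i == j)%:R *: g) else 0.
Proof.
case: k => [|k]; first by rewrite /level big1// => w _; rewrite tuple0 /= mulr0.
rewrite /level (reindex (fun p : 'I_d * k.-tuple 'I_d => cons_tuple p.1 p.2))/=; last first.
  exists (fun t : k.+1.-tuple 'I_d => (thead t, behead_tuple t)) => [[l t] _|t _] /=.
    by congr (_, _); apply/val_inj.
  by case/tupleP: t => l t; apply/val_inj.
rewrite -(pair_bigA _ (fun l (t : k.-tuple 'I_d) =>
  ((l == i)%:R * f t)^* * ((l == j)%:R * g t)))/=.
rewrite (bigD1 i)//= [X in _ + X]big1 ?addr0 => [|l /negPf ->].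
  by apply: eq_bigr => w _; rewrite eqxx mul1r.
by apply: big1 => w _; rewrite mul0r rmorph0 mul0r.
Qed.

(** Creation raises the degree by one, which shifts the series defining the
    inner product of the Fock space. *)
Lemma csum_shift (u : nat -> C) : csummable u ->
  csum (fun k => if k is k'.+1 then u k' else 0) = csum u.
Proof.
have sh (v : nat -> R) : cvgn (series v) ->
    limn (series (fun k => if k is k'.+1 then v k' else 0)) = limn (series v).
  move=> cv; apply: cvg_lim => //; rewrite -cvg_shiftS.
  rewrite (_ : (fun n => _) = series v)//; apply/funext => n.
  by rewrite /series /= big_nat_recl// add0r.
move=> [ru iu]; rewrite /csum -(sh _ ru) -(sh _ iu).
by congr (limn (series _) +i* limn (series _))%C; apply/funext => -[].
Qed.

Lemma ip_creation (i j : 'I_d) x y :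
  ip (creation R i x) (creation R j y) = (i == j)%:R * ip x y.
Proof.
rewrite -ipZr -[RHS]/(csum _) -csum_shift; last exact: level_summable.
by congr csum; apply/funext => k; rewrite -level_creation_pair.
Qed.

Lemma adj_Lstar z : adj (Lstar z) = starL z.
Proof.
by rewrite /Lstar adj_sum; apply: eq_bigr => j _; rewrite adj_scale conjCK.
Qed.

Lemma LstarE z x : Lstar z x = \sum_j (z ord0 j)^* *: creation R j x.
Proof. by rewrite /Lstar bop_sumE. Qed.

Lemma ip_Lstar z w x y : ip (Lstar z x) (Lstar w y) = rowprod z w * ip x y.
Proof.
rewrite !LstarE ip_suml mulr_suml; apply: eq_bigr => i _.
rewrite ip_sumr (bigD1 i)// big1 => [|j /= ji].
  by rewrite ipZl ipZr ip_creation eqxx mul1r conjCK mulrA; exact: addr0.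
by rewrite ipZl ipZr ip_creation eq_sym (negPf ji) mul0r !mulr0.
Qed.

Lemma starL_Lstar z w x : starL z (Lstar w x) = rowprod z w *: x.
Proof. by apply: ip_injr => y; rewrite -adj_Lstar -adjP ip_Lstar ipZr. Qed.

Lemma rowprod_ge0 w : 0 <= rowprod w w.
Proof. by apply: sumr_ge0 => j _; exact: mul_conjC_ge0. Qed.

(** By the Cauchy-Schwarz inequality, |z w^*| < 1 on the ball. *)
Lemma rowprod_neq1 (z w : unit_ball R d) : 1 - rowprod (sval z) (sval w) != 0.
Proof.
have CS : `|rowprod (sval z) (sval w)| ^+ 2 <=
    rowprod (sval w) (sval w) * rowprod (sval z) (sval z).
  have := @preip_CauchySchwarz R 'rV[C]_d (fun u v => rowprod v u) _ _ _ _ (sval w) (sval z).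
  apply=> [x a y y'|x y|x|x].
  - rewrite /rowprod mulr_sumr -big_split; apply: eq_bigr => j _ /=.
    by rewrite !mxE mulrDl mulrA.
  - rewrite /rowprod rmorph_sum; apply: eq_bigr => j _.
    by rewrite /= rmorphM /= conjCK mulrC.
  - exact: rowprod_ge0.
  move/eqP; rewrite psumr_eq0 => [/allP x0|j _]; last exact: mul_conjC_ge0.
  apply/rowP => j; rewrite mxE; apply/eqP.
  by have := x0 j (mem_index_enum j); rewrite /= mul_conjC_eq0.
have lt1 : `|rowprod (sval z) (sval w)| ^+ 2 < 1.
  apply: le_lt_trans CS _.
  exact: mulr_ilt1 (rowprod_ge0 _) (rowprod_ge0 _) (svalP w) (svalP z).
apply: contraTneq lt1 => /subr0_eq <-.
by rewrite normr1 expr1n ltxx.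
Qed.

(** L w^* is a multiple of an isometry, of norm |w| < 1. *)
Lemma resolvent_invertible (w : unit_ball R d) : invertible (bid F2 - Lstar (sval w)).
Proof.
have w0 := rowprod_ge0 (sval w); have w1 := svalP w.
have wE : rowprod (sval w) (sval w) = (complex.Re (rowprod (sval w) (sval w)))%:C.
  by rewrite RRe_real ?ger0_real.
set q := complex.Re _ in wE.
rewrite /= wE in w0 w1; rewrite ler0c in w0; rewrite ltcR in w1.
apply: (@invertible_sub_contraction _ _ _ (Num.sqrt q)) => [|x].
  by rewrite sqrtr_ge0 /= -sqrtr1 ltr_sqrt.
rewrite -(@ler_pXn2r _ 2)// ?nnegrE ?mulr_ge0 ?rnorm_ge0 ?sqrtr_ge0//.
rewrite exprMn sqr_sqrtr// -lecR [leRHS]rmorphM /= -!ip_rnorm ip_Lstar wE.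
exact: lexx.
Qed.

Lemma resolvent_starE (z : unit_ball R d) : resolvent_star z = adj (resolvent z).
Proof.
rewrite /resolvent -binv_adj; last exact: resolvent_invertible.
by rewrite adj_sub adj_bid adj_Lstar.
Qed.

(** With A = zL^* and B = Lw^*, one has A B = z w^* =: c because the creation
    operators satisfy L_i^* L_j = delta_ij; expanding,
    (1 - A) ((1 - A)^-1 + (1 - B)^-1 - 1) (1 - B) = 1 - A B = 1 - c. *)
Lemma resolvent_product (z w : unit_ball R d) :
  resolvent_star z \bo resolvent w =
  (1 - rowprod (sval z) (sval w))^-1 *: (resolvent_star z + resolvent w - bid F2).
Proof.
apply: bopP => h; set c := rowprod _ _; rewrite bcompE bopZE !bopDE bopNE bidE.
have starI : invertible (bid F2 - starL (sval z)).
  exists (resolvent_star z); rewrite resolvent_starE -adj_Lstar -[bid F2]adj_bid -adj_sub.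
  by apply: inverse_of_adj; apply: binvP; exact: resolvent_invertible.
have := binvKr h (resolvent_invertible w); rewrite -/(resolvent w).
set y := resolvent w h; rewrite bopDE bopNE bidE => yh.
have := binvKr h starI; rewrite -/(resolvent_star z).
set u := resolvent_star z h; rewrite bopDE bopNE bidE => uh.
rewrite -[RHS](binvK _ starI) -/(resolvent_star z); congr (resolvent_star z _).
rewrite bopDE bopNE bidE.
rewrite bop_scale -scalerBr.
have -> : u + y - h = u + Lstar (sval w) y by rewrite -yh opprB addrCA addrK addrC.
rewrite bop_add starL_Lstar opprD addrACA uh -/c -yh addrA subrK.
have -> : y - c *: y = (1 - c) *: y by rewrite scalerBl scale1r.
rewrite scalerA mulVf ?scale1r//.
exact: rowprod_neq1.
Qed.

Lemma lsubspace_opS : lsubspace (opS R d).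
Proof. by apply: lsubspace_closure; exact: lsubspace_lspan. Qed.

Lemma opS_resolvent (w : unit_ball R d) : opS R d (resolvent w).
Proof. by apply: subset_closure; apply: sub_lspan; exists w. Qed.

(** The identity is the resolvent at the centre of the ball. *)
Lemma opS_bid : opS R d (bid F2).
Proof.
have p0 : rowprod (0 : 'rV[C]_d) 0 < 1.
  by rewrite /rowprod big1 ?ltr01// => j _; rewrite mxE mul0r.
have <- : resolvent (exist _ 0 p0) = bid F2.
  apply: binv_eq; rewrite /= (_ : Lstar 0 = 0) ?subr0.
    by split; apply: bopP.
  by rewrite /Lstar big1// => j _; rewrite mxE rmorph0 scale0r.
exact: opS_resolvent.
Qed.

Let sumSS : set LF := [set A + adj B | A in opS R d & B in opS R d].

Let lsubspace_sumSS : lsubspace sumSS.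
Proof.
have [S0 SP] := lsubspace_opS.
split; first by exists 0 => //; exists 0 => //; rewrite adj0 addr0.
move=> a _ _ [A SA [B SB <-]] [A' SA' [B' SB' <-]].
exists (a *: A + A'); first exact: SP.
exists (a^* *: B + B'); first exact: SP.
by rewrite adj_conj_linear conjCK scalerDr addrACA.
Qed.

Lemma lsubspace_opSS : lsubspace (opSS R d).
Proof. exact: lsubspace_closure lsubspace_sumSS. Qed.

Lemma opS_sub_opSS : opS R d `<=` opSS R d.
Proof.
move=> A SA; apply: subset_closure; exists A => //; exists 0.
  by case: lsubspace_opS.
by rewrite adj0 addr0.
Qed.

(** S^* S is contained in the closure of S + S^*: for resolvents this is
    [resolvent_product], then the product is extended by sesquilinearity to
    their span and by continuity, one factor at a time, to its closure. *)
Lemma adj_opS_opS (p q : LF) : opS R d p -> opS R d q -> opSS R d (adj p \bo q).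
Proof.
have [E0 EP] := lsubspace_sumSS; have [S0 SP] := lsubspace_opS.
have RR (z w : unit_ball R d) : sumSS (adj (resolvent z) \bo resolvent w).
  rewrite -resolvent_starE resolvent_product resolvent_starE; set a := _^-1.
  exists (a *: (resolvent w - bid F2)).
    rewrite -[X in opS _ _ X]addr0; apply: (SP) => //.
    rewrite addrC -scaleN1r; apply: (SP); [exact: opS_bid|exact: opS_resolvent].
  exists (a^* *: resolvent z).
    by rewrite -[X in opS _ _ X]addr0; apply: (SP) => //; exact: opS_resolvent.
  by rewrite adj_scale conjCK -scalerDr addrC addrA.
have RS (z : unit_ball R d) : forall q : LF,
    lspan (range (@resolvent R d)) q -> sumSS (adj (resolvent z) \bo q).
  apply: lspan_min => [|_ [w _ <-]//].
  split; first by rewrite (_ : _ \bo _ = 0)//; apply: bopP => x; rewrite bcompE linear0.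
  move=> a A B EA EB; rewrite (_ : _ \bo _ =
    a *: (adj (resolvent z) \bo A) + (adj (resolvent z) \bo B)).
    exact: EP.
  by apply: bopP => x; rewrite bcompE bopDE bopZE linearP.
have SS' : forall p q : LF, lspan (range (@resolvent R d)) p ->
    lspan (range (@resolvent R d)) q -> sumSS (adj p \bo q).
  move=> {}p {}q + Sq; move: p; apply: lspan_min => [|_ [w _ <-]]; last exact: RS.
  split; first by rewrite adj0 (_ : _ \bo _ = 0)//; apply: bopP.
  move=> a A B EA EB; rewrite adj_conj_linear.
  rewrite (_ : _ \bo _ = a^* *: (adj A \bo q) + (adj B \bo q)); last exact: bopP.
  exact: EP.
have step1 : forall p q : LF, opS R d p -> lspan (range (@resolvent R d)) q ->
    opSS R d (adj p \bo q).
  move=> {}p {}q Sp Sq; move: p Sp.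
  apply: (@closure_lipschitz R LF LF (fun p => adj p \bo q) (rnorm q) _ sumSS)
    => [x y|x Sx]; last exact: SS'.
  rewrite (_ : _ - _ = adj (x - y) \bo q); last by rewrite adj_sub; apply: bopP.
  by rewrite (le_trans (rnorm_comp _ _))// rnorm_adj mulrC.
move=> Sp Sq.
suff : closure (opSS R d) (adj p \bo q) by exact: closed_closure.
move: q Sq.
apply: (@closure_lipschitz R LF LF (fun q => adj p \bo q) (rnorm p) _ (opSS R d))
  => [x y|x Sx].
  rewrite (_ : _ - _ = adj p \bo (x - y)); last first.
    by apply: bopP => u; rewrite bcompE linearB.
  by rewrite (le_trans (rnorm_comp _ _))// rnorm_adj.
exact: step1.
Qed.

End FockOperators.

(** * The Herglotz transform and the space of mu *)

Section Herglotz.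
Variables (R : realType) (H : hilbertType R).

(** The factors (1 - T) and (1 - T')^* cancel the inverses in the two Herglotz
    transforms, leaving (1 + T) (1 - T'^* ) + (1 - T) (1 + T'^* ), in which the
    terms of degree one cancel. *)
Lemma herglotz_sum_adj (T T' : bop H H) h :
  invertible (bid H - T) -> invertible (bid H - T') ->
  (bid H - T) ((herglotz T + adj (herglotz T')) (adj (bid H - T') h)) =
  2 *: (bid H - (T \bo adj T')) h.
Proof.
move=> iT iT'; rewrite [(herglotz T + _) _]bopDE.
have -> : adj (herglotz T') (adj (bid H - T') h) = h + adj T' h.
  rewrite /herglotz adj_comp bcompE -binv_adj// binvK; last first.
    by have [S /inverse_of_adj ?] := iT'; exists (adj S).
  by rewrite adj_add adj_bid.
rewrite bop_add /herglotz bcompE binvKr//.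
rewrite adj_sub adj_bid !(bopDE, bopNE, bidE, bcompE) !linearD !linearN /=.
set t := adj T' h.
rewrite addrACA [h - t + _]addrACA addNr addr0 [T h - T t + _]addrACA subrr add0r.
by rewrite !scaler_nat !mulr2n opprD.
Qed.

End Herglotz.

Section CompletelyPositive.
Variables (R : realType) (d : nat) (H : hilbertType R).
Local Notation F2 := (fock R d).
Variable mu : bop F2 F2 -> bop H H.
Hypothesis mu_cp : completely_positive (opSS R d) mu.

(** Positivity of mu at |p|^2 - p^* p, a positive element of the operator
    system, compared at the vector h. *)
Lemma cp_le (p : bop F2 F2) h : opS R d p ->
  complex.Re (ip h (mu (adj p \bo p) h)) <=
  rnorm p ^+ 2 * complex.Re (ip h (mu (bid F2) h)).
Proof.
move=> Sp; have [mu_lin mu_pos] := mu_cp; have [SS0 SSP] := lsubspace_opSS R d.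
have SSp := adj_opS_opS Sp Sp; have SS1 := opS_sub_opSS (@opS_bid R d).
have mu0 : mu 0 = 0.
  have := mu_lin 1 0 0 SS0 SS0; rewrite !scale1r addr0.
  by move=> /(congr1 (fun t => t - mu 0)); rewrite addrK subrr => <-.
set c := rnorm p ^+ 2.
(* Shaped so that the linearity of mu on the operator system applies twice. *)
pose T := c%:C *: bid F2 + (-1 *: (adj p \bo p) + 0).
have SSm := SSP (-1) _ _ SSp SS0.
have ST : opSS R d T by exact: SSP.
have := mu_pos 1%N (fun _ _ => T) (fun _ _ => ST).
have T0 : block_positive (fun _ _ : 'I_1 => T).
  move=> x; rewrite !big_ord1; set y := x _.
  rewrite !(bopDE, bopZE, bop0E, bcompE, bidE) addr0 scaleN1r ipBr ipZr -adjP.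
  rewrite !ip_rnorm -rmorphM -rmorphB ler0c subr_ge0 /c -exprMn.
  by rewrite ler_pXn2r ?nnegrE ?mulr_ge0 ?rnorm_ge0// rnorm_bop opnormP.
move=> /(_ T0 (fun=> h)); rewrite !big_ord1 mu_lin// mu_lin// mu0 addr0 scaleN1r.
rewrite bopDE bopNE bopZE ipBr ipZr.
case: (ip h (mu (bid F2) h)) (ip h (mu (_ \bo _) h)) => u v [u' v'].
by rewrite lecE /= => /andP[_]; rewrite mul0r subr0 subr_ge0.
Qed.

End CompletelyPositive.

Section ResolventTensors.
Variables (R : realType) (d : nat) (H : hilbertType R).
Local Notation F2 := (fock R d).
Local Notation ball := (unit_ball R d).
Variable mu : bop F2 F2 -> bop H H.
Hypothesis mu_cp : completely_positive (opSS R d) mu.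
Variable P : P2 mu.

Lemma P2_tensor_le p h : opS R d p ->
  rnorm (P2_tensor P p h) <= rnorm p * rnorm (P2_tensor P (bid F2) h).
Proof.
move=> Sp; have := cp_le mu_cp h Sp; have S1 := @opS_bid R d.
rewrite -(P2_tensor_ip P h h Sp Sp).
have bidid : adj (bid F2) \bo bid F2 = bid F2 by rewrite adj_bid; exact: bopP.
have := P2_tensor_ip P h h S1 S1; rewrite bidid => <-; rewrite !ip_rnorm /=.
by rewrite -exprMn ler_pXn2r ?nnegrE ?mulr_ge0 ?rnorm_ge0.
Qed.

(** The resolvents span a dense subspace of S and p (x) h depends continuously
    on p, by [P2_tensor_le]. The surjections c w allow the vectors of H to be
    renormalized at each point of the ball, as is needed to match the kernel
    functions of K(b). *)
Lemma dense_resolvent_tensor (c : ball -> bop H H) :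
  (forall w h, exists g, c w g = h) ->
  dense (lspan (range (fun i : ball * H => P2_tensor P (resolvent i.1) (c i.1 i.2)))).
Proof.
move=> csurj; set D := lspan _; have sD : lsubspace D by exact: lsubspace_lspan.
have [S0 SP] := lsubspace_opS R d.
apply: (dense_closure_lspan (@P2_tensor_dense _ _ _ _ P) sD) => _ [p Sp [h _ <-]].
have Dq q : lspan (range (@resolvent R d)) q -> opS R d q /\ D (P2_tensor P q h).
  move: q; apply: lspan_min.
    split.
      split=> //; have := P2_tensor_linearl P 1 h S0 S0.
      rewrite !scale1r addr0 => /(congr1 (fun t => t - P2_tensor P 0 h)).
      by rewrite addrK subrr => <-; case: sD.
    move=> a x y [Sx Dx] [Sy Dy]; split; first exact: SP.
    by rewrite P2_tensor_linearl//; apply: sD.2.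
  move=> _ [w _ <-]; split; first exact: opS_resolvent.
  by have [g <-] := csurj w h; apply: sub_lspan; exists (w, g).
apply/closure_rnormP => e e0.
set n := rnorm (P2_tensor P (bid F2) h).
have n0 : 0 <= n by exact: rnorm_ge0.
have n1 : 0 < n + 1 by rewrite ltr_wpDl.
have /closure_rnormP/(_ (e / (n + 1))) [|q /Dq[Sq Dqh]] := Sp.
  by rewrite divr_gt0.
rewrite ltr_pdivlMr// => pq; exists (P2_tensor P q h) => //.
have Sqp := SP (-1) _ _ Sq Sp.
have -> : P2_tensor P p h - P2_tensor P q h = P2_tensor P (-1 *: q + p) h.
  by rewrite P2_tensor_linearl// scaleN1r addrC.
apply: le_lt_trans (P2_tensor_le _ Sqp) _; rewrite scaleN1r addrC -/n.
by have := rnorm_ge0 (p - q); nra.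
Qed.

End ResolventTensors.

(** * The unitary transform onto K(b) *)

Theorem theorem2p8 (R : realType) (d : nat) (hd : (0 < d)%N)
    (H : hilbertType R) (H_nonzero : exists h : H, h != 0) (H_sep : separable H)
    (mu : bop (fock R d) (fock R d) -> bop H H)
    (mu_cp : completely_positive (opSS R d) mu)
    (H2 : rkhs (szego_kernel R d H))
    (b : unit_ball R d -> bop H H) (b_schur : schur H2 b)
    (mu_b : clark_map b mu)
    (P : P2 mu) (K : rkhs (dBR_kernel b)) :
  exists Fb : bop P K,
    unique (fun F : bop P K =>
      forall (p : bop (fock R d) (fock R d)) (h : H) (z : unit_ball R d),
        opS R d p ->
        rkhs_eval K (F (P2_tensor P p h)) z =
        (bid H - b z) (mu (resolvent_star z \bo p) h)) Fb /\
    unitary Fb.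
Proof.
have [binvb _ mu_res] := mu_b.
have /choice[k0 k0P] : forall i : unit_ball R d * H, exists f : K,
    rkhs_eval K f = (fun z => dBR_kernel b z i.1 i.2) /\
    forall g, ip f g = ip i.2 (rkhs_eval K g i.1).
  by move=> [w h]; exact: rkhs_kernel.
pose v (i : unit_ball R d * H) : P :=
  P2_tensor P (resolvent i.1) (adj (bid H - b i.1) i.2).
have v_ip z g p h : opS R d p -> ip (v (z, g)) (P2_tensor P p h) =
    ip g ((bid H - b z) (mu (resolvent_star z \bo p) h)).
  move=> Sp; rewrite P2_tensor_ip//; last exact: opS_resolvent.
  by rewrite adjPr -resolvent_starE.
have gram i j : ip (v i) (v j) = ip (k0 i) (k0 j).
  case: i j => [z g] [w h]; rewrite {2}/v v_ip; last exact: opS_resolvent.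
  rewrite (k0P _).2 (k0P _).1; congr (ip g _).
  rewrite -[RHS]/(dBR_kernel b z w h) mu_res bopZE bop_scale
    herglotz_sum_adj// /dBR_kernel bopZE.
  by rewrite /= scalerA mulrAC mulVf ?mul1r// pnatr_eq0.
have vdense : dense (lspan (range v)).
  apply: (dense_resolvent_tensor mu_cp (c := fun w => adj (bid H - b w))) => w h.
  have [S /inverse_of_adj Sadj] := binvb w; exists (adj S h).
  by have /(congr1 (fun f : bop H H => f h)) := Sadj.2.
have [U Uip Uv] := gram_isometry vdense gram.
(* The reproducing property of K turns point evaluation of U x into an inner
   product in P; the formula and surjectivity both follow from this. *)
have Uk z g x : ip g (rkhs_eval K (U x) z) = ip (v (z, g)) x.
  by rewrite -(k0P (z, g)).2 -Uv Uip.
have UF p h z : opS R d p -> rkhs_eval K (U (P2_tensor P p h)) z =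
    (bid H - b z) (mu (resolvent_star z \bo p) h).
  by move=> Sp; apply: ip_injr => g; rewrite Uk v_ip.
exists U; split; split=> //.
- move=> F FF; apply: (bop_dense_eq (@P2_tensor_dense _ _ _ _ P)) => _ [p Sp [h _ <-]].
  by apply: (@rkhs_eval_inj _ _ _ _ K); apply/funext => z; rewrite UF// FF.
(* U (U^* y) and y have the same inner products with the kernel functions,
   hence the same values. *)
- move=> y; exists (adj U y); apply: (@rkhs_eval_inj _ _ _ _ K).
  apply/funext => z; apply: ip_injr => g.
  by rewrite Uk -adjP Uv (k0P (z, g)).2.
Qed.
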